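(* Let $K$ be a field with $\mathrm{char}(K)\neq 2$. Then $\dim R(\mathfrak{n}_{m,2})=\dim R(\mathfrak{n}_{m,3})$ for all integers $m\geq 1$, where $\mathfrak{n}_{m,c}$ is the free nilpotent Lie algebra over $K$ of rank $m$ and class $c$.
   Context: For a Lie algebra $\mathfrak{g}$ over $K$, let $\mathfrak{g}^{\psi}$ be an isomorphic copy of $\mathfrak{g}$ via $x\mapsto x^{\psi}$, and let $\chi(\mathfrak{g})=\langle \mathfrak{g},\mathfrak{g}^{\psi} \mid [x,x^{\psi}]=0 \text{ for all } x\in\mathfrak{g}\rangle$ (the quotient of the free product of the Lie algebras $\mathfrak{g}$ and $\mathfrak{g}^{\psi}$ by the ideal generated by all $[x,x^{\psi}]$). Let $\alpha:\chi(\mathfrak{g})\to\mathfrak{g}$ be the homomorphism with $\alpha(x)=\alpha(x^{\psi})=x$ for all $x\in\mathfrak{g}$, and $L=L(\mathfrak{g})=\ker(\alpha)$. Define $R(\mathfrak{g})=[\mathfrak{g},[L,\mathfrak{g}^{\psi}]]$, an ideal of $\chi(\mathfrak{g})$, where brackets of subspaces denote linear spans of brackets of their elements. Here $\mathfrak{n}_{m,c}=F/\gamma_{c+1}(F)$ with $F$ free of rank $m$, $\gamma_1(F)=F$ and $\gamma_{k+1}(F)=[F,\gamma_k(F)]$. *)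

(* Defs.v *)
From HB Require Import structures.
From mathcomp Require Import all_boot all_order all_algebra.
From mathcomp Require Import generic_quotient ring_quotient.
From mathcomp Require Import boolp classical_sets functions cardinality.

Set Implicit Arguments.
Unset Strict Implicit.
Unset Printing Implicit Defensive.

Import GRing.Theory.

Local Open Scope classical_set_scope.
Local Open Scope ring_scope.
Local Open Scope quotient_scope.

Section LinearAlgebra.
Context {K : fieldType}.
Implicit Types V W : lmodType K.

Definition subspace V (A : set V) : Prop :=
  A 0 /\ forall (a : K) (u v : V), A u -> A v -> A (a *: u + v).

Definition lspan V (S : set V) : set V := smallest (@subspace V) S.

Definition lin_indep V (B : set V) : Prop :=
  forall (s : seq V) (a : V -> K), uniq s -> (forall v, v \in s -> B v) ->
    \sum_(v <- s) a v *: v = 0 -> forall v, v \in s -> a v = 0.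

Definition basis_of V (U B : set V) : Prop := lin_indep B /\ lspan B = U.

(* dim U = dim U', as cardinals: all bases of a given space are equipotent, so
   it does not matter which ones are compared. *)
Definition same_dim V W (U : set V) (U' : set W) : Prop :=
  exists (B : set V) (B' : set W),
    [/\ basis_of U B, basis_of U' B' & (B #= B')%card].

Lemma lspan_subspace V (S : set V) : subspace (lspan S).
Proof.
split=> [M [[]] //|a u v Su Sv M MS].
by have [[_ +] _] := MS; apply; [exact: Su|exact: Sv].
Qed.

End LinearAlgebra.

HB.mixin Record Lmodule_isLie (K : fieldType) (g : Type)
    of GRing.Lmodule K g := {
  lie : g -> g -> g;
  lieDZl : forall (a : K) (x y z : g),
    lie (a *: x + y) z = a *: lie x z + lie y z;
  lieDZr : forall (a : K) (x y z : g),
    lie z (a *: x + y) = a *: lie z x + lie z y;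
  liexx : forall x : g, lie x x = 0;
  lie_jacobi : forall x y z : g,
    lie x (lie y z) + lie y (lie z x) + lie z (lie x y) = 0
}.

#[short(type="lieAlgType")]
HB.structure Definition LieAlg (K : fieldType) :=
  {g of Lmodule_isLie K g & GRing.Lmodule K g}.

Notation "[ 'lie' x , y ]" := (lie x y)
  (at level 0, format "[ 'lie'  x ,  y ]") : ring_scope.

Section LieTheory.
Context {K : fieldType}.
Implicit Types g h : lieAlgType K.

Lemma lieDr g (z x y : g) : [lie z, x + y] = [lie z, x] + [lie z, y].
Proof. by rewrite -[x]scale1r lieDZr !scale1r. Qed.
Lemma lieDl g (z x y : g) : [lie x + y, z] = [lie x, z] + [lie y, z].
Proof. by rewrite -[x]scale1r lieDZl !scale1r. Qed.
Lemma lier0 g (z : g) : [lie z, 0] = 0.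
Proof. by have := lieDZr (-1) 0 0 z; rewrite scaler0 addr0 scaleN1r addNr. Qed.
Lemma lie0r g (z : g) : [lie 0, z] = 0.
Proof. by have := lieDZl (-1) 0 0 z; rewrite scaler0 addr0 scaleN1r addNr. Qed.
Lemma lieNl g (x z : g) : [lie - x, z] = - [lie x, z].
Proof. by have := lieDZl (-1) x 0 z; rewrite lie0r !addr0 !scaleN1r. Qed.
Lemma lieNC g (x y : g) : [lie x, y] = - [lie y, x].
Proof.
apply/eqP; rewrite -addr_eq0; apply/eqP.
by have := liexx (x + y); rewrite lieDr !lieDl !liexx add0r addr0 addrC.
Qed.

Definition lie_hom g h (f : g -> h) : Prop :=
  (forall (a : K) (x y : g), f (a *: x + y) = a *: f x + f y) /\
  (forall x y : g, f [lie x, y] = [lie f x, f y]).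

Definition lie_comm g (A B : set g) : set g :=
  lspan [set [lie a, b] | a in A & b in B].

(* lcs g k is gamma_k(g) for k >= 1; lcs g 0 is a junk value equal to g. *)
Definition lcs g (k : nat) : set g := iter k.-1 (lie_comm setT) setT.
Arguments lcs : clear implicits.

Definition is_ideal g (I : set g) : Prop :=
  subspace I /\ forall x y : g, I y -> I [lie x, y].

Record lieIdeal g :=
  LieIdeal { ideal_set :> g -> Prop; ideal_setP : is_ideal ideal_set }.

Lemma ideal_gen_subproof g (S : set g) : is_ideal (smallest (@is_ideal g) S).
Proof.
split; first split=> [M [[[]]] //|a u v Su Sv M MS].
  by have [[[_ +] _] _] := MS; apply; [exact: Su|exact: Sv].
by move=> x y Sy M MS; have [[_ +] _] := MS; apply; exact: Sy.
Qed.

Definition ideal_gen g (S : set g) : lieIdeal g :=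
  LieIdeal (ideal_gen_subproof S).

Lemma lcs_subproof g k : is_ideal (lcs g k).
Proof.
rewrite /lcs; set n := k.-1.
set T : nat -> set g := fun n => iter n (lie_comm setT) setT; rewrite -/(T n).
have dec : forall n, T n.+1 `<=` (T n : set g).
  elim=> [//|i IH]; apply: smallest_sub; first exact: lspan_subspace.
  move=> _ [a _ [b Tb <-]]; apply: sub_gen_smallest; exists a => //.
  by exists b => //; exact: IH.
case: n => [|n]; first by split.
split; first exact: lspan_subspace.
move=> x y Ty; apply: sub_gen_smallest; exists x => //; exists y => //.
exact: (dec n).
Qed.

Definition lcs_ideal g k : lieIdeal g := LieIdeal (@lcs_subproof g k).

End LieTheory.

Arguments lcs {K} g k.
Arguments lcs_ideal {K} g k.

Section LieQuotient.
Context {K : fieldType} {g : lieAlgType K} (I : lieIdeal g).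

Definition ideal_mem : g -> bool := fun x => `[< I x >].

Lemma ideal_mem_zmod : zmod_closed ideal_mem.
Proof.
have [[I0 IP] _] := ideal_setP I.
split=> [|x y]; rewrite ?unfold_in; first exact/asboolP.
move=> /asboolP Ix /asboolP Iy; apply/asboolP.
by rewrite addrC -scaleN1r; exact: IP.
Qed.
HB.instance Definition _ := GRing.isZmodClosed.Build g ideal_mem ideal_mem_zmod.

Definition ideal_zmod : zmodClosed g := GRing.ZmodClosed.clone g ideal_mem _.

Definition lieQuot : Type := Quotient.quot ideal_zmod.
HB.instance Definition _ := GRing.Zmodule.on lieQuot.

Definition lieq_pi (x : g) : lieQuot := \pi_(Quotient.quot ideal_zmod) x.
Definition lieq_repr (q : lieQuot) : g := repr q.

Lemma lieq_reprK q : lieq_pi (lieq_repr q) = q.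
Proof. exact: reprK. Qed.

Lemma lieq_piP (x y : g) : lieq_pi x = lieq_pi y <-> I (x - y).
Proof.
rewrite /lieq_pi; split=> [/eqP|H]; last apply/eqP.
  by rewrite -Quotient.idealrBE unfold_in => /asboolP.
by rewrite -Quotient.idealrBE unfold_in; apply/asboolP.
Qed.

Lemma lieq_piD (x y : g) : lieq_pi (x + y) = lieq_pi x + lieq_pi y.
Proof. by rewrite /lieq_pi; exact: (pi_addr (s := Quotient.quot ideal_zmod)). Qed.

Definition lieq_scale (a : K) (q : lieQuot) := lieq_pi (a *: lieq_repr q).
Definition lieq_lie (p q : lieQuot) := lieq_pi [lie lieq_repr p, lieq_repr q].

Lemma lieq_rep (x : g) : I (lieq_repr (lieq_pi x) - x).
Proof. by apply/lieq_piP; rewrite lieq_reprK. Qed.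

Lemma lieq_piZ (a : K) (x : g) : lieq_pi (a *: x) = lieq_scale a (lieq_pi x).
Proof.
have [[I0 IP] _] := ideal_setP I.
apply/esym/lieq_piP; rewrite -scalerBr -[_ *: _]addr0; apply: IP => //.
exact: lieq_rep.
Qed.

Lemma lieq_pi_lie (x y : g) :
  lieq_pi [lie x, y] = lieq_lie (lieq_pi x) (lieq_pi y).
Proof.
have [[I0 IP] IL] := ideal_setP I.
apply/esym/lieq_piP; set x' := lieq_repr _; set y' := lieq_repr _.
have -> : [lie x', y'] - [lie x, y]
    = (-1) *: [lie y', x' - x] + [lie x, y' - y].
  rewrite scaleN1r (lieNC y') opprK lieDl lieNl lieDr.
  by rewrite (lieNC x (- y)) lieNl opprK (lieNC y) addrA subrK.
by apply: IP; apply: IL; exact: lieq_rep.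
Qed.

Fact lieq_scaleA a b q : lieq_scale a (lieq_scale b q) = lieq_scale (a * b) q.
Proof. by rewrite -[q]lieq_reprK -!lieq_piZ scalerA. Qed.
Fact lieq_scale1 : left_id 1 lieq_scale.
Proof. by move=> q; rewrite -[q]lieq_reprK -!lieq_piZ scale1r. Qed.
Fact lieq_scaleDr : right_distributive lieq_scale +%R.
Proof.
move=> a p q; rewrite -[q]lieq_reprK -[p]lieq_reprK.
by rewrite -lieq_piD -!lieq_piZ scalerDr lieq_piD.
Qed.
Fact lieq_scaleDl q : {morph lieq_scale^~ q : a b / a + b}.
Proof.
by move=> a b; rewrite -[q]lieq_reprK -!lieq_piZ scalerDl lieq_piD.
Qed.
HB.instance Definition _ := GRing.Zmodule_isLmodule.Build K lieQuot
  lieq_scaleA lieq_scale1 lieq_scaleDr lieq_scaleDl.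

Lemma lieq_pi_lin (a : K) (x y : g) :
  lieq_pi (a *: x + y) = a *: lieq_pi x + lieq_pi y.
Proof. by rewrite lieq_piD lieq_piZ. Qed.

Lemma lieq_pi0 : lieq_pi 0 = 0.
Proof. by apply: (addrI (lieq_pi 0)); rewrite -lieq_piD !addr0. Qed.

Fact lieq_lieDZl a x y z :
  lieq_lie (a *: x + y) z = a *: lieq_lie x z + lieq_lie y z.
Proof.
rewrite -[x]lieq_reprK -[y]lieq_reprK -[z]lieq_reprK.
by rewrite -lieq_pi_lin -!lieq_pi_lie lieDZl lieq_pi_lin.
Qed.
Fact lieq_lieDZr a x y z :
  lieq_lie z (a *: x + y) = a *: lieq_lie z x + lieq_lie z y.
Proof.
rewrite -[x]lieq_reprK -[y]lieq_reprK -[z]lieq_reprK.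
by rewrite -lieq_pi_lin -!lieq_pi_lie lieDZr lieq_pi_lin.
Qed.
Fact lieq_liexx x : lieq_lie x x = 0.
Proof. by rewrite -[x]lieq_reprK -lieq_pi_lie liexx lieq_pi0. Qed.
Fact lieq_jacobi x y z : lieq_lie x (lieq_lie y z) + lieq_lie y (lieq_lie z x)
  + lieq_lie z (lieq_lie x y) = 0.
Proof.
rewrite -[x]lieq_reprK -[y]lieq_reprK -[z]lieq_reprK.
by rewrite -!lieq_pi_lie -!lieq_piD lie_jacobi lieq_pi0.
Qed.
HB.instance Definition _ := Lmodule_isLie.Build K lieQuot
  lieq_lieDZl lieq_lieDZr lieq_liexx lieq_jacobi.

Lemma lieq_pi_hom : lie_hom lieq_pi.
Proof. by split=> *; [rewrite lieq_pi_lin | rewrite lieq_pi_lie]. Qed.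

(* Only meaningful when f is a Lie homomorphism vanishing on I; see
   lieq_liftE and lieq_lift_hom. *)
Definition lieq_lift (h : lieAlgType K) (f : g -> h) (q : lieQuot) : h :=
  f (lieq_repr q).

Section Lift.
Context {h : lieAlgType K} (f : g -> h).
Hypotheses (fhom : lie_hom f) (fI : forall x, I x -> f x = 0).

Lemma lieq_liftE x : lieq_lift f (lieq_pi x) = f x.
Proof.
have /fI := lieq_rep x; rewrite /lieq_lift -scaleN1r addrC fhom.1 scaleN1r.
by move/eqP; rewrite addrC subr_eq0 => /eqP.
Qed.

Lemma lieq_lift_hom : lie_hom (lieq_lift f).
Proof.
split=> [a p q|p q]; rewrite -[p]lieq_reprK -[q]lieq_reprK.
  by rewrite -lieq_pi_lin !lieq_liftE fhom.1.
by rewrite -lieq_pi_hom.2 !lieq_liftE fhom.2.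
Qed.
End Lift.

End LieQuotient.

(* The free Lie algebra on X consists of the formal Lie expressions in elements
   of X, modulo the congruence generated by the axioms of a Lie algebra over K;
   fl_lift_hom, fl_lift_gen and fl_lift_uniq are its universal property. *)
Section FreeLie.
Context (K : fieldType) (X : Type).

Inductive lterm : Type :=
  | TVar of X
  | TZero
  | TAdd of lterm & lterm
  | TScale of K & lterm
  | TLie of lterm & lterm.

Inductive lterm_eq : lterm -> lterm -> Prop :=
  | Teq_refl t : lterm_eq t t
  | Teq_sym t u : lterm_eq t u -> lterm_eq u t
  | Teq_trans t u v : lterm_eq t u -> lterm_eq u v -> lterm_eq t v
  | Teq_add t t' u u' :
      lterm_eq t t' -> lterm_eq u u' -> lterm_eq (TAdd t u) (TAdd t' u')
  | Teq_scale a t t' : lterm_eq t t' -> lterm_eq (TScale a t) (TScale a t')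
  | Teq_lie t t' u u' :
      lterm_eq t t' -> lterm_eq u u' -> lterm_eq (TLie t u) (TLie t' u')
  | Teq_addA t u v : lterm_eq (TAdd t (TAdd u v)) (TAdd (TAdd t u) v)
  | Teq_addC t u : lterm_eq (TAdd t u) (TAdd u t)
  | Teq_add0 t : lterm_eq (TAdd TZero t) t
  | Teq_addN t : lterm_eq (TAdd (TScale (-1) t) t) TZero
  | Teq_scaleA a b t : lterm_eq (TScale a (TScale b t)) (TScale (a * b) t)
  | Teq_scale1 t : lterm_eq (TScale 1 t) t
  | Teq_scaleDr a t u :
      lterm_eq (TScale a (TAdd t u)) (TAdd (TScale a t) (TScale a u))
  | Teq_scaleDl a b t :
      lterm_eq (TScale (a + b) t) (TAdd (TScale a t) (TScale b t))
  | Teq_lieDZl a t u v : lterm_eq (TLie (TAdd (TScale a t) u) v)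
                                  (TAdd (TScale a (TLie t v)) (TLie u v))
  | Teq_lieDZr a t u v : lterm_eq (TLie v (TAdd (TScale a t) u))
                                  (TAdd (TScale a (TLie v t)) (TLie v u))
  | Teq_liexx t : lterm_eq (TLie t t) TZero
  | Teq_jacobi t u v :
      lterm_eq (TAdd (TAdd (TLie t (TLie u v)) (TLie u (TLie v t)))
                     (TLie v (TLie t u))) TZero.

HB.instance Definition _ := gen_eqMixin lterm.
HB.instance Definition _ := gen_choiceMixin lterm.

Definition lterm_eqb (t u : lterm) : bool := `[< lterm_eq t u >].

Lemma lterm_eqb_equiv : equiv_class_of lterm_eqb.
Proof.
split=> [t|t u|u t v]; first exact/asboolP/Teq_refl.
  by apply/asboolP/asboolP; exact: Teq_sym.
by move=> /asboolP tu /asboolP uv; apply/asboolP; exact: Teq_trans uv.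
Qed.
Canonical lterm_eqb_equiv_rel := EquivRelPack lterm_eqb_equiv.
Canonical lterm_eqb_encModRel := defaultEncModRel lterm_eqb.

Definition freeLie : Type := {eq_quot lterm_eqb}.
HB.instance Definition _ := Choice.on freeLie.

Definition fl_pi (t : lterm) : freeLie := \pi_({eq_quot lterm_eqb}) t.
Definition fl_repr (q : freeLie) : lterm := repr q.

Lemma fl_reprK q : fl_pi (fl_repr q) = q. Proof. exact: reprK. Qed.

Lemma fl_piP t u : fl_pi t = fl_pi u <-> lterm_eq t u.
Proof.
split=> [/eqP|tu]; first by rewrite eqmodE => /asboolP.
by apply/eqP; rewrite eqmodE; apply/asboolP.
Qed.

Lemma fl_rep t : lterm_eq (fl_repr (fl_pi t)) t.
Proof. by apply/fl_piP; rewrite fl_reprK. Qed.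

Definition fl_add p q := fl_pi (TAdd (fl_repr p) (fl_repr q)).
Definition fl_scale a q := fl_pi (TScale a (fl_repr q)).
Definition fl_lie p q := fl_pi (TLie (fl_repr p) (fl_repr q)).

Lemma fl_piD t u : fl_pi (TAdd t u) = fl_add (fl_pi t) (fl_pi u).
Proof. by apply/esym/fl_piP/Teq_add; exact: fl_rep. Qed.
Lemma fl_piZ a t : fl_pi (TScale a t) = fl_scale a (fl_pi t).
Proof. by apply/esym/fl_piP/Teq_scale; exact: fl_rep. Qed.
Lemma fl_pi_lie t u : fl_pi (TLie t u) = fl_lie (fl_pi t) (fl_pi u).
Proof. by apply/esym/fl_piP/Teq_lie; exact: fl_rep. Qed.

Let flE := (fl_piD, fl_piZ, fl_pi_lie).

Fact fl_addA : associative fl_add.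
Proof.
move=> x y z; rewrite -[x]fl_reprK -[y]fl_reprK -[z]fl_reprK -!flE.
exact/fl_piP/Teq_addA.
Qed.
Fact fl_addC : commutative fl_add.
Proof.
by move=> x y; rewrite -[x]fl_reprK -[y]fl_reprK -!flE; exact/fl_piP/Teq_addC.
Qed.
Fact fl_add0 : left_id (fl_pi TZero) fl_add.
Proof. by move=> x; rewrite -[x]fl_reprK -!flE; exact/fl_piP/Teq_add0. Qed.
Fact fl_addN : left_inverse (fl_pi TZero) (fl_scale (-1)) fl_add.
Proof. by move=> x; rewrite -[x]fl_reprK -!flE; exact/fl_piP/Teq_addN. Qed.
HB.instance Definition _ :=
  GRing.isZmodule.Build freeLie fl_addA fl_addC fl_add0 fl_addN.

Lemma fl_addE (x y : freeLie) : x + y = fl_add x y. Proof. by []. Qed.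
Lemma fl_zeroE : (0 : freeLie) = fl_pi TZero. Proof. by []. Qed.

Fact fl_scaleA a b x : fl_scale a (fl_scale b x) = fl_scale (a * b) x.
Proof. by rewrite -[x]fl_reprK -!flE; exact/fl_piP/Teq_scaleA. Qed.
Fact fl_scale1 : left_id 1 fl_scale.
Proof. by move=> x; rewrite -[x]fl_reprK -!flE; exact/fl_piP/Teq_scale1. Qed.
Fact fl_scaleDr : right_distributive fl_scale +%R.
Proof.
move=> a x y; rewrite !fl_addE -[x]fl_reprK -[y]fl_reprK -!flE.
exact/fl_piP/Teq_scaleDr.
Qed.
Fact fl_scaleDl x : {morph fl_scale^~ x : a b / a + b}.
Proof.
move=> a b; rewrite !fl_addE -[x]fl_reprK -!flE; exact/fl_piP/Teq_scaleDl.
Qed.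
HB.instance Definition _ := GRing.Zmodule_isLmodule.Build K freeLie
  fl_scaleA fl_scale1 fl_scaleDr fl_scaleDl.

Lemma fl_scaleE a (x : freeLie) : a *: x = fl_scale a x. Proof. by []. Qed.

Fact fl_lieDZl a x y z : fl_lie (a *: x + y) z = a *: fl_lie x z + fl_lie y z.
Proof.
rewrite !fl_addE !fl_scaleE -[x]fl_reprK -[y]fl_reprK -[z]fl_reprK -!flE.
exact/fl_piP/Teq_lieDZl.
Qed.
Fact fl_lieDZr a x y z : fl_lie z (a *: x + y) = a *: fl_lie z x + fl_lie z y.
Proof.
rewrite !fl_addE !fl_scaleE -[x]fl_reprK -[y]fl_reprK -[z]fl_reprK -!flE.
exact/fl_piP/Teq_lieDZr.
Qed.
Fact fl_liexx x : fl_lie x x = 0.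
Proof. by rewrite -[x]fl_reprK -!flE; exact/fl_piP/Teq_liexx. Qed.
Fact fl_jacobi x y z :
  fl_lie x (fl_lie y z) + fl_lie y (fl_lie z x) + fl_lie z (fl_lie x y) = 0.
Proof.
rewrite !fl_addE -[x]fl_reprK -[y]fl_reprK -[z]fl_reprK -!flE.
exact/fl_piP/Teq_jacobi.
Qed.
HB.instance Definition _ := Lmodule_isLie.Build K freeLie
  fl_lieDZl fl_lieDZr fl_liexx fl_jacobi.

Lemma fl_lieE (x y : freeLie) : [lie x, y] = fl_lie x y. Proof. by []. Qed.

Definition fl_gen (x : X) : freeLie := fl_pi (TVar x).

Section Lift.
Context {h : lieAlgType K} (f : X -> h).

Fixpoint lterm_eval (t : lterm) : h :=
  match t with
  | TVar x => f x
  | TZero => 0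
  | TAdd t u => lterm_eval t + lterm_eval u
  | TScale a t => a *: lterm_eval t
  | TLie t u => [lie lterm_eval t, lterm_eval u]
  end.

Definition fl_lift (q : freeLie) : h := lterm_eval (fl_repr q).

Lemma lterm_eval_eq t u : lterm_eq t u -> lterm_eval t = lterm_eval u.
Proof.
elim=> //=; do ?by [move=> * ; congruence].
- by move=> *; rewrite addrA.
- by move=> *; rewrite addrC.
- by move=> *; rewrite add0r.
- by move=> *; rewrite scaleN1r addNr.
- by move=> *; rewrite scalerA.
- by move=> *; rewrite scale1r.
- by move=> *; rewrite scalerDr.
- by move=> *; rewrite scalerDl.
- by move=> *; rewrite lieDZl.
- by move=> *; rewrite lieDZr.
- by move=> *; rewrite liexx.
- by move=> *; rewrite lie_jacobi.
Qed.

Lemma fl_lift_pi t : fl_lift (fl_pi t) = lterm_eval t.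
Proof. exact/lterm_eval_eq/fl_rep. Qed.

Lemma fl_lift_gen x : fl_lift (fl_gen x) = f x.
Proof. by rewrite fl_lift_pi. Qed.

Lemma fl_lift_hom : lie_hom fl_lift.
Proof.
split=> [a x y|x y]; rewrite -[x]fl_reprK -[y]fl_reprK.
  by rewrite fl_addE fl_scaleE -!flE !fl_lift_pi.
by rewrite fl_lieE -!flE !fl_lift_pi.
Qed.

Lemma fl_lift_uniq (k : freeLie -> h) :
  lie_hom k -> (forall x, k (fl_gen x) = f x) -> forall q, k q = fl_lift q.
Proof.
move=> khom kgen q; rewrite -[q]fl_reprK fl_lift_pi.
have k0 : k 0 = 0.
  by have := khom.1 (-1) 0 0; rewrite scaler0 addr0 scaleN1r addNr.
elim: (fl_repr q) => [x||t IHt u IHu|a t IH|t IHt u IHu] /=.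
- exact: kgen.
- exact: k0.
- rewrite -IHt -IHu.
  by have := khom.1 1 (fl_pi t) (fl_pi u); rewrite !scale1r fl_addE -flE.
- by have := khom.1 a (fl_pi t) 0; rewrite k0 !addr0 fl_scaleE -flE IH.
by rewrite -IHt -IHu -khom.2 fl_lieE -flE.
Qed.

End Lift.
End FreeLie.

Section Constructions.
Context {K : fieldType}.
Implicit Types g h : lieAlgType K.

(* The elements that must vanish for f to be a homomorphism of Lie algebras. *)
Definition hom_defect g h (f : g -> h) : set h :=
  [set r | (exists (a : K) (x y : g), r = f (a *: x + y) - (a *: f x + f y)) \/
           (exists x y : g, r = f [lie x, y] - [lie f x, f y])].

Definition freeprod_ideal g h : lieIdeal (freeLie K (g + h)) :=
  ideal_gen (hom_defect (fun x : g => fl_gen K (inl x : g + h)) `|`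
             hom_defect (fun y : h => fl_gen K (inr y : g + h))).

Definition freeprod g h : lieAlgType K := lieQuot (freeprod_ideal g h).

Definition fp_inl g h (x : g) : freeprod g h :=
  lieq_pi (freeprod_ideal g h) (fl_gen K (inl x)).
Definition fp_inr g h (y : h) : freeprod g h :=
  lieq_pi (freeprod_ideal g h) (fl_gen K (inr y)).

(* chi g, with the copy of g in the left factor of the free product of g with
   itself and g^psi in the right one. *)
Definition chi_ideal g : lieIdeal (freeprod g g) :=
  ideal_gen [set [lie fp_inl g x, fp_inr g x] | x in setT].

Definition chi g : lieAlgType K := lieQuot (chi_ideal g).

Definition chi_in g (x : g) : chi g := lieq_pi (chi_ideal g) (fp_inl g x).
Definition chi_psi g (x : g) : chi g := lieq_pi (chi_ideal g) (fp_inr g x).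

(* The homomorphism that is the identity on both factors. *)
Definition fp_fold g : freeprod g g -> g :=
  lieq_lift (fl_lift (fun s : g + g => match s with inl x => x | inr x => x end)).

(* alpha_hom, alpha_in and alpha_psi characterize this map. *)
Definition alpha g : chi g -> g := lieq_lift (@fp_fold g).

Lemma ideal_gen_ker g h (f : g -> h) (S : set g) :
  lie_hom f -> (forall x, S x -> f x = 0) -> forall x, ideal_gen S x -> f x = 0.
Proof.
move=> fhom fS; apply: (@smallest_sub _ _ _ [set x | f x = 0]) => //.
split=> [|x y /= fy]; last by rewrite fhom.2 fy lier0.
split=> [|a u v /= fu fv] /=; last by rewrite fhom.1 fu fv scaler0 addr0.
by have := fhom.1 (-1) 0 0; rewrite scaler0 addr0 scaleN1r addNr.
Qed.

Lemma fp_inl_hom g h : lie_hom (@fp_inl g h).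
Proof.
split=> [a x y|x y]; rewrite /fp_inl.
  rewrite -lieq_pi_lin; apply/lieq_piP; apply: sub_gen_smallest.
  by left; left; exists a, x, y.
rewrite -(lieq_pi_hom _).2; apply/lieq_piP; apply: sub_gen_smallest.
by left; right; exists x, y.
Qed.

Lemma fp_inr_hom g h : lie_hom (@fp_inr g h).
Proof.
split=> [a x y|x y]; rewrite /fp_inr.
  rewrite -lieq_pi_lin; apply/lieq_piP; apply: sub_gen_smallest.
  by right; left; exists a, x, y.
rewrite -(lieq_pi_hom _).2; apply/lieq_piP; apply: sub_gen_smallest.
by right; right; exists x, y.
Qed.

Lemma fp_fold_subproof g (x : freeLie K (g + g)) : freeprod_ideal g g x ->
  fl_lift (fun s : g + g => match s with inl x => x | inr x => x end) x = 0.
Proof.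
set f := fl_lift _; have fhom : lie_hom f by exact: fl_lift_hom.
have fB u v : f (u - v) = f u - f v.
  by rewrite addrC -scaleN1r fhom.1 scaleN1r addrC.
apply: ideal_gen_ker => // r [[]|[]].
- by move=> [a [y [z ->]]]; rewrite fB fhom.1 /f !fl_lift_gen subrr.
- by move=> [y [z ->]]; rewrite fB fhom.2 /f !fl_lift_gen subrr.
- by move=> [a [y [z ->]]]; rewrite fB fhom.1 /f !fl_lift_gen subrr.
- by move=> [y [z ->]]; rewrite fB fhom.2 /f !fl_lift_gen subrr.
Qed.

Lemma fp_fold_hom g : lie_hom (@fp_fold g).
Proof.
apply: lieq_lift_hom; [exact: fl_lift_hom | exact: fp_fold_subproof].
Qed.

Lemma fp_fold_inl g (x : g) : fp_fold (fp_inl g x) = x.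
Proof.
rewrite /fp_fold lieq_liftE ?fl_lift_gen //; first exact: fl_lift_hom.
exact: fp_fold_subproof.
Qed.

Lemma fp_fold_inr g (x : g) : fp_fold (fp_inr g x) = x.
Proof.
rewrite /fp_fold lieq_liftE ?fl_lift_gen //; first exact: fl_lift_hom.
exact: fp_fold_subproof.
Qed.

Lemma alpha_subproof g (x : freeprod g g) : chi_ideal g x -> fp_fold x = 0.
Proof.
apply: ideal_gen_ker; first exact: fp_fold_hom.
move=> _ [y _ <-].
by rewrite (fp_fold_hom g).2 fp_fold_inl fp_fold_inr liexx.
Qed.

Lemma alpha_hom g : lie_hom (@alpha g).
Proof. by apply: lieq_lift_hom; [exact: fp_fold_hom|exact: alpha_subproof]. Qed.

Lemma alpha_in g (x : g) : alpha (chi_in x) = x.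
Proof.
rewrite /alpha lieq_liftE ?fp_fold_inl //; first exact: fp_fold_hom.
exact: alpha_subproof.
Qed.

Lemma alpha_psi g (x : g) : alpha (chi_psi x) = x.
Proof.
rewrite /alpha lieq_liftE ?fp_fold_inr //; first exact: fp_fold_hom.
exact: alpha_subproof.
Qed.

Definition chiL g : set (chi g) := [set z | alpha z = 0].

Definition chiR g : set (chi g) :=
  lie_comm (range (@chi_in g)) (lie_comm (@chiL g) (range (@chi_psi g))).

End Constructions.

Arguments chi {K} g.
Arguments chiL {K} g.
Arguments chiR {K} g.

Definition free_nilpotent (K : fieldType) (m c : nat) : lieAlgType K :=
  lieQuot (lcs_ideal (freeLie K 'I_m) c.+1).

(* Main.v *)
From HB Require Import structures.
From mathcomp Require Import all_boot all_order all_algebra.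
From mathcomp Require Import boolp classical_sets functions cardinality.
Require Import Defs.

Set Implicit Arguments.
Unset Strict Implicit.
Unset Printing Implicit Defensive.

Import GRing.Theory.

Local Open Scope classical_set_scope.
Local Open Scope ring_scope.

(** Write x' for the copy of x in g^psi, and put c x = x + x', v x = x - x' and
    w x y = [v x, v y] in chi(g).  When 2 is invertible the relations of chi(g)
    become [c x, v y] = v [x, y] and [c x, c y] + [v x, v y] = 2 c [x, y]
    ([chi_cv], [chi_cc]).  They imply [w x y, v z] = v [[x, y], z] ([chi_wv]),
    so that L is spanned by the v x and the w x y ([chiL_sub]); the w x y behave
    like the elements x /\ y of an exterior square.  Expanding the brackets in
    the definition of R(g) then shows that R(g) is spanned by the elements
    f x y z = w [x, y] z + w [y, z] x + w [z, x] y, the boundaries of the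
    x /\ y /\ z ([chiR_span]).

    Since w x y acts as the derivation induced by [x, y], antisymmetry of
    [w x y, w z t] yields an exchange law, f [x, y] z t = - f [z, t] x y
    ([chi_f_exchange]).  If gamma_4(g) = 0, it forces w to vanish on
    gamma_3 x gamma_2, and hence f to vanish as soon as one argument is in
    gamma_3 or two are in gamma_2.  For generators e_i of g, the space R(g) is
    therefore spanned by the f e_i e_j e_k with i < j < k and the
    f [e_i, e_j] e_k e_l with i < j, k < l and (i, j) < (k, l)
    ([chiR_gen_span]).  This holds for n_{m,2} and for n_{m,3}, with the same
    indices.

    It remains to see that in both cases these elements are linearly
    independent.  Both algebras map onto the free Lie algebra N of class 2, for
    which chi(N) can be written down: it is N + N + N /\ N, where N /\ N
    carries the values of w.  The images of the spanning elements in N /\ N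
    have a dual family of coordinates ([R_dual]).  So R(n_{m,2}) and
    R(n_{m,3}) have bases indexed by one and the same set. *)

(** * A decision procedure for identities in abelian groups *)

(** The calculations in chi(g) end with identities between sums of signed terms
    of a Lie algebra, to which no ring structure is attached.  They are decided
    by comparing the integer coefficients of the terms. *)
Inductive zexp :=
  ZVar of nat | ZZero | ZAdd of zexp & zexp | ZOpp of zexp.

Fixpoint zeval (V : zmodType) (env : seq V) (e : zexp) : V :=
  match e with
  | ZVar i => env`_i
  | ZZero => 0
  | ZAdd a b => zeval env a + zeval env b
  | ZOpp a => - zeval env a
  end.

Fixpoint zcoef (e : zexp) (i : nat) : int :=
  match e with
  | ZVar j => (i == j)%:Z
  | ZZero => 0
  | ZAdd a b => zcoef a i + zcoef b i
  | ZOpp a => - zcoef a i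
  end.

(** An out-of-range variable evaluates to the default 0, so only the positions
    of [env] contribute. *)
Lemma zevalE (V : zmodType) (env : seq V) e :
  zeval env e = \sum_(i < size env) env`_i *~ zcoef e i.
Proof.
elim: e => [j||a IHa b IHb|a IHa] /=.
- have [jlt|jge] := ltnP j (size env); last first.
    rewrite nth_default // big1 // => i _.
    case: eqP => [ij|_]; last exact: mulr0z.
    by move: (ltn_ord i); rewrite ij ltnNge jge.
  rewrite (bigD1 (Ordinal jlt)) //= eqxx big1 ?addr0 //.
  by move=> i /eqP ij; case: eqP => [/= e|//]; case: ij; apply/val_inj.
- by rewrite big1 // => i _; rewrite mulr0z.
- by rewrite IHa IHb -big_split; apply: eq_bigr => i _; rewrite mulrzDr.
by rewrite IHa -sumrN; apply: eq_bigr => i _; rewrite mulrNz.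
Qed.

Lemma zeval_eq (V : zmodType) (env : seq V) e1 e2 :
  all (fun i => zcoef e1 i == zcoef e2 i) (iota 0 (size env)) ->
  zeval env e1 = zeval env e2.
Proof.
move=> /allP h; rewrite !zevalE; apply: eq_bigr => i _.
by rewrite (eqP (h i _)) // mem_iota /=.
Qed.

Ltac zmod_index x env :=
  lazymatch env with
  | x :: _ => constr:(0%N)
  | _ :: ?r => let n := zmod_index x r in constr:(n.+1)
  end.
Ltac zmod_add x env :=
  match env with
  | _ => let n := zmod_index x env in env
  | _ => constr:(x :: env)
  end.
Ltac zmod_env t env :=
  lazymatch t with
  | 0 => env
  | ?a + ?b => let e := zmod_env a env in zmod_env b e
  | - ?a => zmod_env a env
  | _ => zmod_add t env
  end.
Ltac zmod_reify t env :=
  lazymatch t with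
  | 0 => constr:(ZZero)
  | ?a + ?b => let x := zmod_reify a env in let y := zmod_reify b env in
               constr:(ZAdd x y)
  | - ?a => let x := zmod_reify a env in constr:(ZOpp x)
  | _ => let n := zmod_index t env in constr:(ZVar n)
  end.
Ltac zmod :=
  lazymatch goal with |- @eq ?T ?l ?r =>
    let env := zmod_env l (@nil T) in
    let env := zmod_env r env in
    let a := zmod_reify l env in
    let b := zmod_reify r env in
    apply: (@zeval_eq _ env a b); vm_compute; reflexivity
  end.

(** * Linear maps, subspaces and Lie brackets *)

Section LinearMaps.
Context {K : fieldType}.
Implicit Types V W : lmodType K.

Lemma lspan_min V (S A : set V) :
  subspace A -> (forall x, S x -> A x) -> forall x, lspan S x -> A x.
Proof. by move=> sA SA; apply: smallest_sub. Qed.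

Lemma mem_lspan V (S : set V) x : S x -> lspan S x.
Proof. exact: sub_gen_smallest. Qed.

Section Subspace.
Context {V : lmodType K} (A : set V) (subA : subspace A).

Lemma subspace0 : A 0.
Proof. exact: subA.1. Qed.

Lemma subspaceD u v : A u -> A v -> A (u + v).
Proof. by move=> Au Av; rewrite -[u]scale1r; exact: subA.2. Qed.

Lemma subspaceZ a u : A u -> A (a *: u).
Proof.
by move=> Au; rewrite -[_ *: _]addr0; apply: subA.2 => //; exact: subA.1.
Qed.

Lemma subspaceN u : A u -> A (- u).
Proof. by rewrite -scaleN1r; exact: subspaceZ. Qed.

Lemma subspaceZ_inv a u : a != 0 -> A (a *: u) -> A u.
Proof. by move=> a0 /(subspaceZ a^-1); rewrite scalerA mulVf // scale1r. Qed.

End Subspace.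

Definition lin V W (h : V -> W) : Prop :=
  forall (a : K) x y, h (a *: x + y) = a *: h x + h y.

Lemma lin0 V W (h : V -> W) : lin h -> h 0 = 0.
Proof.
by move=> H; have := H (-1) 0 0; rewrite scaler0 addr0 scaleN1r addNr.
Qed.

Lemma linD V W (h : V -> W) : lin h -> {morph h : x y / x + y}.
Proof. by move=> H x y; rewrite -[x]scale1r H !scale1r. Qed.
Lemma linZ V W (h : V -> W) : lin h -> forall a, {morph h : x / a *: x}.
Proof. by move=> H a x; rewrite -[_ *: x]addr0 H lin0 ?addr0. Qed.
Lemma linN V W (h : V -> W) : lin h -> {morph h : x / - x}.
Proof. by move=> H x; rewrite -scaleN1r linZ // scaleN1r. Qed.
Lemma linB V W (h : V -> W) : lin h -> {morph h : x y / x - y}.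
Proof. by move=> H x y; rewrite linD // linN. Qed.

Lemma subspace_preim V W (h : V -> W) (A : set W) :
  lin h -> subspace A -> subspace (h @^-1` A).
Proof.
move=> hl sA; split=> [|a u v Au Av]; rewrite /preimage /=.
  by rewrite (lin0 hl); exact: subspace0.
by rewrite hl; exact: sA.2.
Qed.

Lemma subspace_ker V W (h : V -> W) : lin h -> subspace [set x | h x = 0].
Proof.
move=> hl; split=> [|a u v /= hu hv] /=; first exact: lin0.
by rewrite hl hu hv scaler0 addr0.
Qed.

Lemma lin_sum V W (h : V -> W) (I : Type) (r : seq I) (F : I -> V) :
  lin h -> h (\sum_(i <- r) F i) = \sum_(i <- r) h (F i).
Proof.
move=> H; elim: r => [|i r IH]; first by rewrite !big_nil lin0.
by rewrite !big_cons linD // IH.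
Qed.

Lemma eq_oppr0 V (x : V) : (2%:R : K) != 0 -> x = - x -> x = 0.
Proof.
move=> two_neq0 /eqP; rewrite -addr_eq0 -mulr2n -scaler_nat scaler_eq0.
by rewrite (negPf two_neq0) => /eqP.
Qed.

(** Independence and injectivity both follow by applying the functional [co j]
    to a relation between the [e i]. *)
Lemma dual_family_basis V (J : choiceType) (D : set J) (e : J -> V)
    (co : J -> V -> K) (U : set V) :
  (forall j, D j -> lin (co j : V -> K^o)) ->
  (forall i j, D i -> D j -> co j (e i) = (i == j)%:R) ->
  lspan (e @` D) = U ->
  basis_of U (e @` D) /\ {in D &, injective e}.
Proof.
move=> colin coe spU.
have einj : {in D &, injective e}.
  move=> i j; rewrite !inE => Di Dj eij; have := coe i i Di Di.
  rewrite eij coe // eqxx; case: eqVneq => // _ /eqP.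
  by rewrite eq_sym oner_eq0.
split=> //; split=> // s a us sB sum0 v vs.
have [j Dj ej] := sB v vs.
have := congr1 (co j) sum0.
rewrite (lin0 (colin j Dj)) (lin_sum _ _ (colin j Dj)).
rewrite (bigD1_seq v) //= (linZ (colin j Dj)) -ej coe // eqxx.
rewrite /GRing.scale /= mulr1 big1_seq ?addr0 // => u /andP[uv us'].
have [i Di ei] := sB u us'.
rewrite -ei (linZ (colin j Dj)) coe //; case: eqVneq => [eqij|_].
  by move: uv; rewrite -ei eqij eqxx.
by rewrite /GRing.scale /= mulr0.
Qed.

End LinearMaps.

Section LieCalculus.
Context {K : fieldType}.
Implicit Types g h : lieAlgType K.

Lemma lieNr g (x z : g) : [lie z, - x] = - [lie z, x].
Proof. by rewrite lieNC lieNl opprK lieNC. Qed.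
Lemma lieBl g (x y z : g) : [lie x - y, z] = [lie x, z] - [lie y, z].
Proof. by rewrite lieDl lieNl. Qed.
Lemma lieBr g (x y z : g) : [lie z, x - y] = [lie z, x] - [lie z, y].
Proof. by rewrite lieDr lieNr. Qed.
Lemma lieZl g a (x z : g) : [lie a *: x, z] = a *: [lie x, z].
Proof. by have := lieDZl a x 0 z; rewrite lie0r !addr0. Qed.
Lemma lieZr g a (x z : g) : [lie z, a *: x] = a *: [lie z, x].
Proof. by have := lieDZr a x 0 z; rewrite lier0 !addr0. Qed.

(** The Jacobi identity, saying that bracketing with x is a derivation. *)
Lemma lie_deriv g (x y z : g) :
  [lie x, [lie y, z]] = [lie [lie x, y], z] + [lie y, [lie x, z]].
Proof.
have /eqP := lie_jacobi x y z; rewrite -addrA addr_eq0 => /eqP ->.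
by rewrite (lieNC _ z) (lieNC x z) lieNr; zmod.
Qed.

Lemma lin_lier h (x : h) : lin (fun y => [lie x, y]).
Proof. by move=> a y z; rewrite lieDZr. Qed.

Lemma lin_liel h (x : h) : lin (fun y => [lie y, x]).
Proof. by move=> a y z; rewrite lieDZl. Qed.

End LieCalculus.

Lemma free_ind (K : fieldType) (X : Type) (S : set (freeLie K X)) :
  subspace S -> (forall a b, S a -> S b -> S [lie a, b]) ->
  (forall x, S (fl_gen K x)) -> forall a, S a.
Proof.
move=> sS Sl Sg a; rewrite -[a]fl_reprK.
elim: (fl_repr a) => [x||t IHt u IHu|k t IHt|t IHt u IHu].
- exact: Sg.
- exact: subspace0 sS.
- by rewrite fl_piD -fl_addE; exact: subspaceD.
- by rewrite fl_piZ -fl_scaleE; exact: subspaceZ.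
by rewrite fl_pi_lie -fl_lieE; exact: Sl.
Qed.

(** * The structure of chi(g) in characteristic other than 2 *)

Section ChiCalculus.
Context {K : fieldType} (g : lieAlgType K).
Hypothesis two_neq0 : (2%:R : K) != 0.
Implicit Types x y z t u : g.

Let p := @chi_in K g.
Let q := @chi_psi K g.

Lemma chi_in_hom : lie_hom p.
Proof.
split=> *; rewrite /p /chi_in.
  by rewrite (fp_inl_hom _ _).1 lieq_pi_lin.
by rewrite (fp_inl_hom _ _).2 (lieq_pi_hom _).2.
Qed.

Lemma chi_psi_hom : lie_hom q.
Proof.
split=> *; rewrite /q /chi_psi.
  by rewrite (fp_inr_hom _ _).1 lieq_pi_lin.
by rewrite (fp_inr_hom _ _).2 (lieq_pi_hom _).2.
Qed.

Lemma chi_comm x : [lie p x, q x] = 0.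
Proof.
rewrite /p /q /chi_in /chi_psi -(lieq_pi_hom _).2 -(lieq_pi0 (chi_ideal g)).
by apply/lieq_piP; rewrite subr0; apply: sub_gen_smallest; exists x.
Qed.

Let pD := linD chi_in_hom.1.
Let qD := linD chi_psi_hom.1.

(** The defining relation of chi(g), polarized. *)
Lemma chi_swap x y : [lie p x, q y] = [lie q x, p y].
Proof.
have := chi_comm (x + y).
rewrite pD qD lieDl !lieDr !chi_comm add0r addr0.
by move/eqP; rewrite addr_eq0 => /eqP ->; rewrite -lieNC.
Qed.

Definition chi_c x : chi g := chi_in x + chi_psi x.
Definition chi_v x : chi g := chi_in x - chi_psi x.
Definition chi_w x y : chi g := [lie chi_v x, chi_v y].
Local Notation c := chi_c.
Local Notation v := chi_v.
Local Notation w := chi_w.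

Lemma chi_v_lin : lin v.
Proof.
move=> a x y; rewrite /v -/p -/q chi_in_hom.1 chi_psi_hom.1.
by rewrite opprD addrACA scalerBr.
Qed.

Lemma chi_w_linl y : lin (w^~ y).
Proof. by move=> a x z; rewrite /w chi_v_lin lieDZl. Qed.
Lemma chi_w_linr y : lin (w y).
Proof. by move=> a x z; rewrite /w chi_v_lin lieDZr. Qed.

Lemma chi_wNC x y : w x y = - w y x.
Proof. exact: lieNC. Qed.

Lemma chi_cv x y : [lie c x, v y] = v [lie x, y].
Proof.
rewrite /c /v lieDl !lieBr -/p -/q chi_swap addrA subrK.
by rewrite chi_in_hom.2 chi_psi_hom.2.
Qed.

Lemma chi_cc x y : [lie c x, c y] = c [lie x, y] + c [lie x, y] - w x y.
Proof.
rewrite /w /c /v !(lieDl, lieNl, lieDr, lieNr) -/p -/q chi_swap.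
rewrite chi_in_hom.2 chi_psi_hom.2; zmod.
Qed.

(** By [chi_cc], w x y is 2 c [x, y] - [c x, c y], and the c act on the v z as
    inner derivations of g.  So v(g) is a Lie triple system under the triple
    product [[x, y], z]. *)
Lemma chi_wv x y z : [lie w x y, v z] = v [lie [lie x, y], z].
Proof.
have -> : w x y = c [lie x, y] + c [lie x, y] - [lie c x, c y].
  by rewrite chi_cc; zmod.
have := lie_deriv (c x) (c y) (v z); rewrite !chi_cv => /eqP.
rewrite -subr_eq => /eqP ccv; rewrite lieBl lieDl !chi_cv -ccv.
by rewrite lie_deriv (linD chi_v_lin); zmod.
Qed.

Lemma chi_cw z x y : [lie c z, w x y] = w [lie z, x] y + w x [lie z, y].
Proof. by rewrite /w lie_deriv !chi_cv. Qed.

Lemma chi_ww x y z t :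
  [lie w x y, w z t] = w [lie [lie x, y], z] t + w z [lie [lie x, y], t].
Proof. by rewrite {2}/w lie_deriv !chi_wv. Qed.

(** If w x y is read as x /\ y, this is the Chevalley-Eilenberg boundary of
    x /\ y /\ z. *)
Definition chi_f x y z : chi g :=
  w [lie x, y] z + w [lie y, z] x + w [lie z, x] y.
Local Notation f := chi_f.

Lemma chi_f_cyc x y z : f x y z = f y z x.
Proof. rewrite /f; zmod. Qed.

Lemma chi_f_swap x y z : f x y z = - f y x z.
Proof.
rewrite /f (lieNC y x) (lieNC x z) (lieNC z y) !(linN (chi_w_linl _)); zmod.
Qed.

Lemma chi_fxx x z : f x x z = 0.
Proof.
rewrite /f liexx (lin0 (chi_w_linl _)) (lieNC z x) (linN (chi_w_linl _)); zmod.
Qed.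

Lemma chi_f_lin1 y z : lin (fun x => f x y z).
Proof.
move=> a x x'; rewrite /f lieDZl lieDZr !chi_w_linl chi_w_linr.
by rewrite !scalerDr; zmod.
Qed.

Lemma chi_f_lin2 x z : lin (fun y => f x y z).
Proof. by move=> a y y'; rewrite !(chi_f_cyc x) chi_f_lin1. Qed.

Lemma chi_f_lin3 x y : lin (fun z => f x y z).
Proof. by move=> a z z'; rewrite !(chi_f_cyc x) chi_f_lin2. Qed.

(** Compute [w x y, w z t] in two ways, by letting either factor act as a
    derivation on the other. *)
Lemma chi_f_exchange x y z t : f [lie x, y] z t = - f [lie z, t] x y.
Proof.
have := chi_ww x y z t; rewrite lieNC chi_ww => /eqP.
rewrite eq_sym -subr_eq0 opprK => /eqP ww; apply/eqP; rewrite -addr_eq0.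
apply/eqP; rewrite -{}ww /f (lieNC t [lie x, y]) (lieNC y [lie z, t]).
rewrite !(linN (chi_w_linl _)) (chi_wNC z) (chi_wNC x [lie _ , _]).
rewrite (chi_wNC [lie z, t] [lie x, y]); zmod.
Qed.

Lemma chi_cf u x y z :
  [lie c u, f x y z] = f [lie u, x] y z + f x [lie u, y] z + f x y [lie u, z].
Proof.
rewrite /f !lieDr !chi_cw (lie_deriv u x y) (lie_deriv u y z) (lie_deriv u z x).
rewrite !(linD (chi_w_linl _)); zmod.
Qed.

Lemma chi_vf u x y z : [lie v u, f x y z] = 0.
Proof.
rewrite /f !lieDr !(lieNC (v u)) !chi_wv -!opprD -!(linD chi_v_lin) -!lieDl.
rewrite (lieNC [lie x, y]) (lieNC [lie y, z]) (lieNC [lie z, x]) -!opprD lieNl.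
have -> : [lie z, [lie x, y]] + [lie x, [lie y, z]] + [lie y, [lie z, x]] = 0.
  by rewrite -(lie_jacobi x y z); zmod.
by rewrite lie0r oppr0 (lin0 chi_v_lin) oppr0.
Qed.

Lemma chi_ind (S : set (chi g)) :
  subspace S -> (forall a b, S a -> S b -> S [lie a, b]) ->
  (forall x, S (p x)) -> (forall x, S (q x)) -> forall a, S a.
Proof.
move=> sS Sl Sp Sq a; rewrite -[a]lieq_reprK; move: (lieq_repr a) => b.
rewrite -[b]lieq_reprK; move: (lieq_repr b) => d.
have hom2 := lieq_pi_hom (chi_ideal g).
have hom1 := lieq_pi_hom (freeprod_ideal g g).
pose r d := lieq_pi (chi_ideal g) (lieq_pi (freeprod_ideal g g) d).
apply: (@free_ind _ _ (r @^-1` S)) d.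
- by apply: subspace_preim => // k x y; rewrite /r hom1.1 hom2.1.
- by move=> x y /= Sx Sy; rewrite /r hom1.2 hom2.2; exact: Sl.
by case=> x; [exact: Sp|exact: Sq].
Qed.

Let vw : set (chi g) := range v `|` [set w x y | x in setT & y in setT].

Let vw_v x : lspan vw (v x).
Proof. by apply: mem_lspan; left; exists x. Qed.

Let vw_w x y : lspan vw (w x y).
Proof. by apply: mem_lspan; right; exists x => //; exists y. Qed.

Let vw_subspace : subspace (lspan vw) := lspan_subspace vw.

Let vw_c u l : lspan vw l -> lspan vw [lie c u, l].
Proof.
move: l; apply: lspan_min; first by apply: (subspace_preim (@lin_lier _ _ _)).
move=> _ [[x _ <-]|[x _ [y _ <-]]].
  by rewrite chi_cv.
by rewrite chi_cw; apply: (subspaceD vw_subspace).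
Qed.

Let vw_vl u l : lspan vw l -> lspan vw [lie v u, l].
Proof.
move: l; apply: lspan_min; first by apply: (subspace_preim (@lin_lier _ _ _)).
move=> _ [[x _ <-]|[x _ [y _ <-]]].
  exact: vw_w.
by rewrite lieNC chi_wv; apply: (subspaceN vw_subspace).
Qed.

Let vw_lie l l' : lspan vw l -> lspan vw l' -> lspan vw [lie l, l'].
Proof.
move=> vwl vwl'; move: l vwl; apply: lspan_min.
  by apply: (subspace_preim (@lin_liel _ _ _)).
move=> _ [[x _ <-]|[x _ [y _ <-]]].
  exact: vw_vl.
have -> : [lie w x y, l'] = [lie v x, [lie v y, l']] - [lie v y, [lie v x, l']].
  by rewrite (lie_deriv (v x)) -/(w x y); zmod.
apply: (subspaceD vw_subspace); last apply: (subspaceN vw_subspace).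
  by do 2!apply: vw_vl.
by do 2!apply: vw_vl.
Qed.

Let two_p x : 2%:R *: p x = c x + v x.
Proof. by rewrite scaler_nat /c /v mulr2n -/p; zmod. Qed.

Let two_q x : 2%:R *: q x = c x - v x.
Proof. by rewrite scaler_nat /c /v mulr2n -/q; zmod. Qed.

Let vw_p x l : lspan vw l -> lspan vw [lie p x, l].
Proof.
move=> vwl; apply: (subspaceZ_inv vw_subspace two_neq0).
rewrite -lieZl two_p lieDl.
by apply: (subspaceD vw_subspace); [exact: vw_c|exact: vw_vl].
Qed.

(** The span of the v x and w x y is killed by alpha and is a subalgebra stable
    under the action of g.  Together with g it exhausts chi(g), and alpha is
    injective on g; so it contains the whole kernel of alpha. *)
Lemma chiL_sub :
  chiL g `<=` lspan (range v `|` [set w x y | x in setT & y in setT]).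
Proof.
rewrite -/vw => a alpha_a.
have alpha_vw l : lspan vw l -> alpha l = 0.
  have sk := subspace_ker (alpha_hom g).1.
  have av x : alpha (v x) = 0.
    by rewrite /v (linB (alpha_hom g).1) alpha_in alpha_psi subrr.
  apply: (lspan_min sk) => _ [[x _ <-]|[x _ [y _ <-]]] //=.
  by rewrite (alpha_hom g).2 !av lier0.
have [x vwx] : exists x, lspan vw (a - p x).
  move: a {alpha_a}; apply: chi_ind => [|a b [x ax] [y ay]|x|x].
  - split=> [|k a b [x ax] [y ay]].
      exists 0; rewrite (lin0 chi_in_hom.1) subr0.
      exact: (subspace0 vw_subspace).
    exists (k *: x + y); rewrite chi_in_hom.1 opprD addrACA -scalerBr.
    exact: vw_subspace.2.
  - exists [lie x, y]; rewrite chi_in_hom.2.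
    set l := a - _ in ax; set l' := b - _ in ay.
    have -> : [lie a, b] - [lie p x, p y] =
        [lie l, l'] + [lie p x, l'] - [lie p y, l].
      by rewrite (lieNC (p y)) /l /l' !(lieDl, lieDr, lieNl, lieNr); zmod.
    apply: (subspaceD vw_subspace); last first.
      by apply: (subspaceN vw_subspace); exact: vw_p.
    by apply: (subspaceD vw_subspace) => //; [exact: vw_lie|exact: vw_p].
  - by exists x; rewrite subrr; exact: (subspace0 vw_subspace).
  exists x; rewrite -opprB -/(v x); exact: (subspaceN vw_subspace).
have := alpha_vw _ vwx; rewrite (linB (alpha_hom g).1) alpha_a alpha_in sub0r.
move/eqP; rewrite oppr_eq0 => /eqP x0.
by move: vwx; rewrite x0 (lin0 chi_in_hom.1) subr0.
Qed.

(* As p u = (c u + v u) / 2 and q z = (c z - v z) / 2, the next two lemmas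
   compute 4 [p u, [l, q z]] for the spanning elements l of L; in the second the
   element w x y is traded for v [x, y] at the cost of an f. *)
Let cv_v x z u : [lie c u + v u, [lie v x, c z - v z]] = - f x z u.
Proof.
have -> : [lie v x, c z - v z] = v [lie x, z] - w x z.
  by rewrite lieBr (lieNC _ (c z)) chi_cv (lieNC z) (linN chi_v_lin) opprK.
rewrite lieDl !(lieBr (v _) (w _ _)) chi_cv -/(w u _) chi_cw.
rewrite (lieNC (v u)) chi_wv.
rewrite (lieNC u [lie x, z]) (linN chi_v_lin) /f (lieNC z u).
rewrite (linN (chi_w_linl _)) (chi_wNC u) (chi_wNC x); zmod.
Qed.

Let cv_w x y z :
  [lie w x y, c z - v z] = - [lie v [lie x, y], c z - v z] - f x y z.
Proof.
rewrite !(lieBr (c z) (v z)) (lieNC (w x y) (c z)) (lieNC (v _) (c z)).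
rewrite chi_cw chi_cv chi_wv.
rewrite -/(w _ z) (lieNC z [lie x, y]) (linN chi_v_lin) (lieNC z y).
by rewrite (linN (chi_w_linr _)) /f (chi_wNC x); zmod.
Qed.

Definition chi_fs : set (chi g) := [set r | exists x y z, r = f x y z].

Lemma chiR_span : chiR g = lspan chi_fs.
Proof.
have sF := lspan_subspace chi_fs.
have Ff x y z : lspan chi_fs (f x y z) by apply: mem_lspan; exists x, y, z.
have four_neq0 : (2%:R * 2%:R : K) != 0 by rewrite mulf_neq0.
have four l z u : (2%:R * 2%:R) *: [lie p u, [lie l, q z]] =
    [lie c u + v u, [lie l, c z - v z]].
  by rewrite -two_p -two_q !lieZr !lieZl scalerA.
apply/seteqP; split; last first.
  apply: lspan_min; first exact: lspan_subspace.
  move=> _ [x [z [u ->]]].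
  apply: (subspaceZ_inv (lspan_subspace _) (a := - (2%:R * 2%:R)^-1)).
    by rewrite oppr_eq0 invr_eq0.
  rewrite scaleNr -scalerN -cv_v -four scalerA mulVf // scale1r.
  apply: mem_lspan; exists (p u); first by exists u.
  exists [lie v x, q z] => //; apply: mem_lspan.
  exists (v x); last by exists (q z) => //; exists z.
  by rewrite /chiL /= /v (linB (alpha_hom g).1) alpha_in alpha_psi subrr.
have Fv x z u : lspan chi_fs [lie c u + v u, [lie v x, c z - v z]].
  by rewrite cv_v; exact: (subspaceN sF).
have Fw x y z u : lspan chi_fs [lie c u + v u, [lie w x y, c z - v z]].
  rewrite cv_w (lieBr (- _) (f _ _ _)) lieNr.
  apply: (subspaceD sF); apply: (subspaceN sF) => //.
  rewrite lieDl chi_vf addr0 chi_cf.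
  by apply: (subspaceD sF) => //; apply: (subspaceD sF).
have Fl l z u : chiL g l -> lspan chi_fs [lie p u, [lie l, q z]].
  move=> /chiL_sub Ll; apply: (subspaceZ_inv sF four_neq0); rewrite four.
  move: l Ll; apply: lspan_min.
    pose h l := [lie c u + v u, [lie l, c z - v z]].
    apply: (subspace_preim (h := h) _ sF).
    by move=> a l l'; rewrite /h lieDZl lieDZr.
  by move=> _ [[x _ <-]|[x _ [y _ <-]]].
apply: lspan_min => // _ [_ [u _ <-] [b Lb <-]].
move: b Lb; apply: lspan_min.
  exact: (subspace_preim (@lin_lier _ _ _) sF).
by move=> _ [l Ll [_ [z _ <-] <-]]; exact: Fl.
Qed.

End ChiCalculus.

(** * Generators of R(g) when gamma_4(g) = 0 *)

Definition pair_lt m (a b : 'I_m * 'I_m) : bool :=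
  (enum_rank a < enum_rank b)%N.

(** Indices of the basis of R: triples for f e_a e_b e_d, and pairs of pairs for
    f [e_a, e_b] e_c e_d. *)
Definition R_idx (m : nat) : Type :=
  ('I_m * 'I_m * 'I_m) + ('I_m * 'I_m) * ('I_m * 'I_m).

Definition R_sorted m : set (R_idx m) := fun j =>
  match j with
  | inl (a, b, d) => (a < b)%N && (b < d)%N
  | inr (s, t) => [&& (s.1 < s.2)%N, (t.1 < t.2)%N & pair_lt s t]
  end.

Section ClassThree.
Context {K : fieldType} (g : lieAlgType K).
Hypothesis two_neq0 : (2%:R : K) != 0.
Hypothesis nil4 : forall x y z t : g, [lie [lie [lie x, y], z], t] = 0.
Implicit Types x y z t u s : g.
Local Notation w := (@chi_w K g).
Local Notation f := (@chi_f K g).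

Lemma comm_comm x y z t : [lie [lie x, y], [lie z, t]] = 0.
Proof. by rewrite lie_deriv nil4 (lieNC z) nil4 oppr0 addr0. Qed.

(** Take f [s, u] x y = - f [x, y] s u with s = [z, t].  On the left only
    w [x, y] [s, u] survives; it appears on the right too, together with
    - w [u, [x, y]] s, which must therefore vanish. *)
Lemma chi_w_g3_g2 x y u z t : w [lie u, [lie x, y]] [lie z, t] = 0.
Proof.
set a := [lie [lie z, t], u].
have /eqP := chi_f_exchange [lie z, t] u x y; rewrite -/a -addr_eq0.
rewrite /chi_f comm_comm (lieNC y a) !nil4 oppr0 !(lin0 (chi_w_linl _)).
rewrite -/a (chi_wNC a) => /eqP <-; zmod.
Qed.

Lemma chi_f_g3 x y u z t : f [lie [lie x, y], u] z t = 0.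
Proof.
rewrite /chi_f nil4 (lieNC t) nil4 oppr0 !(lin0 (chi_w_linl _)) add0r addr0.
by rewrite chi_wNC (lieNC _ u) (linN (chi_w_linl _)) chi_w_g3_g2 !oppr0.
Qed.

Lemma chi_f_g2_g2 x y z t u : f [lie x, y] [lie z, t] u = 0.
Proof.
rewrite /chi_f comm_comm (lieNC _ u) (linN (chi_w_linl _)) !chi_w_g3_g2.
by rewrite (lin0 (chi_w_linl _)) oppr0 !addr0.
Qed.

(* [gen_ind] says that g is spanned by the e i and the commutators. *)
Section Generators.
Context {m : nat} (e : 'I_m -> g).
Hypothesis gen_ind : forall P : set g, subspace P ->
  (forall i, P (e i)) -> (forall x y, P [lie x, y]) -> forall x, P x.

Definition R_gen (j : R_idx m) : chi g :=
  match j with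
  | inl (a, b, d) => f (e a) (e b) (e d)
  | inr (s, t) => f [lie e s.1, e s.2] (e t.1) (e t.2)
  end.

Section Span.
Variable T : set (chi g).
Hypothesis sT : subspace T.
Hypothesis T_gen : forall j, R_sorted j -> T (R_gen j).

(* f is alternating, so the indices can be sorted. *)
Let f_gen3 i j k : T (f (e i) (e j) (e k)).
Proof.
have T0 := subspace0 sT; have TN := subspaceN sT.
have lt12 (a b d : 'I_m) : (a < b)%N -> T (f (e a) (e b) (e d)).
  move=> ab; have [bd|db|/val_inj ->] := ltngtP b d.
  - by apply: (T_gen (j := inl (a, b, d))); rewrite /= ab bd.
  - have [ad|da|/val_inj <-] := ltngtP a d.
    + rewrite chi_f_swap chi_f_cyc; apply: TN.
      by apply: (T_gen (j := inl (a, d, b))); rewrite /= ad db.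
    + rewrite -chi_f_cyc.
      by apply: (T_gen (j := inl (d, a, b))); rewrite /= ab da.
    by rewrite -chi_f_cyc chi_fxx.
  by rewrite chi_f_cyc chi_fxx.
have [|ji|/val_inj ->] := ltngtP i j; first exact: lt12.
  by rewrite chi_f_swap; apply/TN/lt12.
by rewrite chi_fxx.
Qed.

(* Both pairs of indices can be sorted by antisymmetry, and by the exchange law
   the two pairs can be swapped. *)
Let f_gen4 i j k l : T (f [lie e i, e j] (e k) (e l)).
Proof.
have T0 := subspace0 sT; have TN := subspaceN sT.
have f_swap23 x y z : f x y z = - f x z y.
  by rewrite chi_f_cyc chi_f_swap -chi_f_cyc.
have lt22 (a b : 'I_m * 'I_m) : (a.1 < a.2)%N -> (b.1 < b.2)%N ->
    T (f [lie e a.1, e a.2] (e b.1) (e b.2)).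
  move=> a12 b12; have [ab|ba|] := ltngtP (enum_rank a) (enum_rank b).
  - by apply: (T_gen (j := inr (a, b))); rewrite /= a12 b12.
  - rewrite chi_f_exchange; apply: TN.
    by apply: (T_gen (j := inr (b, a))); rewrite /= a12 b12.
  move=> /val_inj/enum_rank_inj ->; set r := f _ _ _.
  have -> : r = 0 by apply: (eq_oppr0 two_neq0); exact: chi_f_exchange.
  exact: T0.
have lt1 (a b d h : 'I_m) : (a < b)%N -> T (f [lie e a, e b] (e d) (e h)).
  move=> ab; have [dh|hd|/val_inj ->] := ltngtP d h.
  - exact: (lt22 (a, b) (d, h)).
  - by rewrite f_swap23; apply: TN; exact: (lt22 (a, b) (h, d)).
  by rewrite chi_f_cyc chi_fxx.
have [|ji|/val_inj ->] := ltngtP i j; first exact: lt1.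
  by rewrite lieNC (linN (chi_f_lin1 _ _)); apply/TN/lt1.
by rewrite liexx (lin0 (chi_f_lin1 _ _)).
Qed.

Let T_ind (h : g -> chi g) : lin h -> (forall i, T (h (e i))) ->
  (forall x y, T (h [lie x, y])) -> forall x, T (h x).
Proof. by move=> hl; apply: gen_ind; exact: subspace_preim. Qed.

Let f_comm x y z t : T (f [lie x, y] z t).
Proof.
have T0 := subspace0 sT.
move: x; apply: (T_ind (h := fun x => f [lie x, y] z t)) => [a x x'|i|x x'].
- by rewrite lieDZl chi_f_lin1.
- move: y; apply: (T_ind (h := fun y => f [lie e i, y] z t)) => [a y y'|j|y y'].
  + by rewrite lieDZr chi_f_lin1.
  + move: z; apply: (T_ind (h := fun z => f _ z t)) => [|k|z z'].
    * exact: chi_f_lin2.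
    * move: t; apply: (T_ind (h := fun t => f _ _ t)) => [|//|t t'].
        exact: chi_f_lin3.
      by rewrite -chi_f_cyc chi_f_g2_g2.
    by rewrite chi_f_g2_g2.
  by rewrite lieNC (linN (chi_f_lin1 _ _)) chi_f_g3 oppr0.
by rewrite chi_f_g3.
Qed.

Lemma chi_f_span x y z : T (f x y z).
Proof.
move: x; apply: (T_ind (h := fun x => f x y z)) => [|i|//].
  exact: chi_f_lin1.
move: y; apply: (T_ind (h := fun y => f _ y z)) => [|j|y y'].
- exact: chi_f_lin2.
- move: z; apply: (T_ind (h := fun z => f _ _ z)) => [|//|z z'].
    exact: chi_f_lin3.
  by rewrite -chi_f_cyc.
by rewrite chi_f_cyc.
Qed.

End Span.

Lemma chiR_gen_span : chiR g = lspan (R_gen @` @R_sorted m).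
Proof.
rewrite chiR_span //; apply/seteqP; split.
  apply: lspan_min => [|_ [x [y [z ->]]]]; first exact: lspan_subspace.
  apply: chi_f_span => [|j js]; first exact: lspan_subspace.
  by apply: mem_lspan; exists j.
apply: lspan_min => [|_ [[[[a b] d]|[s t]] _ <-]]; first exact: lspan_subspace.
  by apply: mem_lspan; exists (e a), (e b), (e d).
by apply: mem_lspan; eexists _, _, _.
Qed.

End Generators.
End ClassThree.

(** * A model of chi(N) for the free Lie algebra N of class 2 *)

Lemma chi_lift_ex (K : fieldType) (g h : lieAlgType K) (a b : g -> h) :
  lie_hom a -> lie_hom b -> (forall x, [lie a x, b x] = 0) ->
  exists F : chi g -> h, [/\ lie_hom F, forall x, F (chi_in x) = a x &
    forall x, F (chi_psi x) = b x].
Proof.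
move=> ah bh ab.
pose F0 := fl_lift
  (fun s : g + g => match s with inl x => a x | inr x => b x end).
have F0h : lie_hom F0 by exact: fl_lift_hom.
have F0l x : F0 (fl_gen K (inl x)) = a x by rewrite /F0 fl_lift_gen.
have F0r x : F0 (fl_gen K (inr x)) = b x by rewrite /F0 fl_lift_gen.
have F00 x : freeprod_ideal g g x -> F0 x = 0.
  apply: (ideal_gen_ker F0h) => r
    [[[k [y [z ->]]]|[y [z ->]]]|[[k [y [z ->]]]|[y [z ->]]]].
  - by rewrite (linB F0h.1) F0h.1 !F0l ah.1 subrr.
  - by rewrite (linB F0h.1) F0h.2 !F0l ah.2 subrr.
  - by rewrite (linB F0h.1) F0h.1 !F0r bh.1 subrr.
  by rewrite (linB F0h.1) F0h.2 !F0r bh.2 subrr.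
pose F1 : freeprod g g -> h := lieq_lift F0.
have F1h : lie_hom F1 by exact: lieq_lift_hom.
have F1l x : F1 (fp_inl g x) = a x by rewrite /F1 lieq_liftE.
have F1r x : F1 (fp_inr g x) = b x by rewrite /F1 lieq_liftE.
have F10 x : chi_ideal g x -> F1 x = 0.
  by apply: (ideal_gen_ker F1h) => _ [y _ <-]; rewrite F1h.2 F1l F1r ab.
exists (lieq_lift F1 : chi g -> h); split=> [|x|x]; first exact: lieq_lift_hom.
  by rewrite /chi_in lieq_liftE.
by rewrite /chi_psi lieq_liftE.
Qed.

Section Model.
Context (K : fieldType) (m : nat).

(** The free nilpotent Lie algebra of class 2, with a larger centre: a row
    vector consisting of m entries for the generators and of the m * m entries
    of a matrix for the commutators.  Commutators are antisymmetric matrices,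
    but allowing all matrices gives plain coordinates. *)
Definition heis : Type := 'rV[K]_(m + m * m).
HB.instance Definition _ := GRing.Lmodule.on heis.
Implicit Types x y z : heis.

Definition heis_lie x y : heis :=
  row_mx 0 (mxvec ((lsubmx x)^T *m lsubmx y - (lsubmx y)^T *m lsubmx x)).

Let heis_lieNC x y : heis_lie x y = - heis_lie y x.
Proof. by rewrite /heis_lie opp_row_mx oppr0 -[in RHS]linearN opprB. Qed.

Let heis_lie_linr x : lin (heis_lie x).
Proof.
move=> a y z; rewrite /heis_lie scale_row_mx add_row_mx scaler0 addr0.
congr row_mx; rewrite -linearP; congr mxvec.
by rewrite !linearP /= mulmxDl -scalemxAl scalerBr opprD addrACA.
Qed.

Let heis_lie_linl y : lin (heis_lie^~ y).
Proof.
by move=> a x z; rewrite !(heis_lieNC _ y) heis_lie_linr scalerN -opprD.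
Qed.

Let heis_liexx x : heis_lie x x = 0.
Proof. by rewrite /heis_lie subrr linear0 row_mx0. Qed.

Let heis_lie2 x y z : heis_lie x (heis_lie y z) = 0.
Proof.
by rewrite {1}/heis_lie row_mxKl trmx0 mul0mx mulmx0 subrr linear0 row_mx0.
Qed.

Fact heis_lieDZl a x y z :
  heis_lie (a *: x + y) z = a *: heis_lie x z + heis_lie y z.
Proof. exact: heis_lie_linl. Qed.
Fact heis_lieDZr a x y z :
  heis_lie z (a *: x + y) = a *: heis_lie z x + heis_lie z y.
Proof. exact: heis_lie_linr. Qed.
Fact heis_jacobi x y z : heis_lie x (heis_lie y z) + heis_lie y (heis_lie z x)
  + heis_lie z (heis_lie x y) = 0.
Proof. by rewrite !heis_lie2 !addr0. Qed.
HB.instance Definition _ := Lmodule_isLie.Build K heis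
  heis_lieDZl heis_lieDZr heis_liexx heis_jacobi.

Lemma heis_nil x y z : [lie x, [lie y, z]] = 0.
Proof. exact: heis_lie2. Qed.

(** The adjoint action as a matrix, so that actions on [heis] and on its
    exterior square become matrix products. *)
Definition heis_ad x : 'M[K]_(m + m * m) := lin1_mx (heis_lie x).

Lemma heis_adE x y : y *m heis_ad x = [lie x, y] :> 'rV_(m + m * m).
Proof.
pose L := GRing.isLinear.Build K heis heis *:%R (heis_lie x) (heis_lie_linr x).
pose l : {linear heis -> heis} := HB.pack (heis_lie x) L.
exact: (mul_rV_lin1 l y).
Qed.

Lemma heis_ad_lin : lin heis_ad.
Proof.
move=> a x y; apply/row_matrixP => i.
rewrite !rowE mulmxDr -scalemxAr !(heis_adE _ (delta_mx 0 i : heis)).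
exact: (lieDZl a x y (delta_mx 0 i : heis)).
Qed.

Lemma heis_ad_comm x y : heis_ad [lie x, y] = 0.
Proof.
apply/row_matrixP => i; rewrite !rowE mulmx0 heis_adE.
by rewrite lieNC heis_nil oppr0.
Qed.

Lemma heis_adM x y : heis_ad x *m heis_ad y = 0.
Proof.
apply/row_matrixP => i; rewrite !rowE mulmx0 mulmxA.
by rewrite !heis_adE heis_nil.
Qed.

(** The exterior square of [heis], in the space of square matrices, and the
    action of [heis] on it by derivations. *)
Definition wedge x y : 'M[K]_(m + m * m) := x^T *m y - y^T *m x.
Definition act x (t : 'M[K]_(m + m * m)) : 'M[K]_(m + m * m) :=
  (heis_ad x)^T *m t + t *m heis_ad x.

Lemma wedgeNC x y : wedge x y = - wedge y x.
Proof. by rewrite opprB. Qed.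
Lemma wedgexx x : wedge x x = 0.
Proof. exact: subrr. Qed.
Lemma wedge_linl y : lin (wedge^~ y).
Proof.
move=> a x z; rewrite /wedge !linearP /= mulmxDl -scalemxAl scalerBr.
by rewrite scalerN addrACA.
Qed.
Lemma wedge_linr y : lin (wedge y).
Proof. by move=> a x z; rewrite !(wedgeNC y) wedge_linl scalerN opprD. Qed.
Lemma act_linr x : lin (act x).
Proof.
move=> a t u; rewrite /act mulmxDl mulmxDr -scalemxAl -scalemxAr.
by rewrite scalerDr addrACA.
Qed.
Lemma act_linl t : lin (act^~ t).
Proof.
move=> a x y; rewrite /act heis_ad_lin linearP /= mulmxDl mulmxDr.
by rewrite -scalemxAl -scalemxAr scalerDr addrACA.
Qed.
Lemma act_wedge x y z :
  act x (wedge y z) = wedge [lie x, y] z + wedge y [lie x, z].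
Proof.
rewrite /act /wedge -!heis_adE !trmx_mul mulmxBr mulmxBl !mulmxA.
by rewrite addrACA -opprD addrACA [in X in - X]addrC opprD.
Qed.
Lemma act_comm x y t : act [lie x, y] t = 0.
Proof. by rewrite /act heis_ad_comm trmx0 mul0mx mulmx0 addr0. Qed.
Lemma actC x y t : act x (act y t) = act y (act x t).
Proof.
have ad0 u v : (heis_ad u)^T *m ((heis_ad v)^T *m t) = 0.
  by rewrite mulmxA -trmx_mul heis_adM trmx0 mul0mx.
have ad0' u v : t *m heis_ad u *m heis_ad v = 0.
  by rewrite -mulmxA heis_adM mulmx0.
have actE u v : act u (act v t) = (heis_ad u)^T *m t *m heis_ad v +
    (heis_ad v)^T *m t *m heis_ad u.
  rewrite {1}/act {1}/act mulmxDr ad0 add0r mulmxA.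
  by rewrite {1}/act mulmxDl ad0' addr0.
by rewrite !actE addrC.
Qed.

Definition heis_f x y z : 'M[K]_(m + m * m) :=
  wedge [lie x, y] z + wedge [lie y, z] x + wedge [lie z, x] y.

(** chi(N) in the coordinates c, v, w: the triple (x, y, t) stands for
    c x + v y + t, where t ranges over a space containing the exterior square,
    in which w takes its values.  The bracket records the relations
    w x y = [v x, v y] = 2 c [x, y] - [c x, c y] and [c x, v y] = v [x, y]; the
    elements t commute with each other and with the v y because N has class
    2. *)
Definition chimod : Type := (heis * heis * 'M[K]_(m + m * m))%type.
HB.instance Definition _ := GRing.Lmodule.on chimod.

Definition chimod_lie (X Y : chimod) : chimod :=
  ([lie X.1.1, Y.1.1] + [lie X.1.1, Y.1.1],
   [lie X.1.1, Y.1.2] - [lie Y.1.1, X.1.2],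
   act X.1.1 Y.2 - act Y.1.1 X.2 + wedge X.1.2 Y.1.2 - wedge X.1.1 Y.1.1).

Let chimod_lieNC X Y : chimod_lie X Y = - chimod_lie Y X.
Proof.
rewrite /chimod_lie; congr (_, _, _) => /=.
- by rewrite lieNC opprD.
- by rewrite opprB.
by rewrite (wedgeNC Y.1.2) (wedgeNC Y.1.1); zmod.
Qed.

Let chimod_lie_linl Y : lin (chimod_lie^~ Y).
Proof.
move=> a X Z; rewrite /chimod_lie; congr (_, _, _) => /=.
- by rewrite lieDZl scalerDr addrACA.
- by rewrite lieDZl lieDZr scalerBr opprD addrACA.
rewrite act_linl act_linr !wedge_linl.
have combine (h : 'M[K]_(m + m * m) -> 'M[K]_(m + m * m)) p q r s p' q' r' s' :
    {morph h : x y / x + y} -> {morph h : x / - x} ->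
    (h p + p') - (h q + q') + (h r + r') - (h s + s') =
    h (p - q + r - s) + (p' - q' + r' - s').
  by move=> hD hN; rewrite !(hD, hN); zmod.
exact: (combine (fun t => a *: t) _ _ _ _ _ _ _ _ (scalerDr a) (scalerN a)).
Qed.

Fact chimod_lieDZl a X Y Z :
  chimod_lie (a *: X + Y) Z = a *: chimod_lie X Z + chimod_lie Y Z.
Proof. exact: chimod_lie_linl. Qed.
Fact chimod_lieDZr a X Y Z :
  chimod_lie Z (a *: X + Y) = a *: chimod_lie Z X + chimod_lie Z Y.
Proof. by rewrite !(chimod_lieNC Z) chimod_lie_linl scalerN opprD. Qed.
Fact chimod_liexx X : chimod_lie X X = 0.
Proof.
rewrite /chimod_lie; congr (_, _, _) => /=.
- by rewrite liexx addr0.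
- exact: subrr.
by rewrite !wedgexx subrr add0r subrr.
Qed.

Let act_comm2 x y t : act ([lie x, y] + [lie x, y]) t = 0.
Proof. by rewrite (linD (act_linl t)) act_comm addr0. Qed.
Let act_sum x (t u r s : 'M[K]_(m + m * m)) :
  act x (t - u + r - s) = act x t - act x u + act x r - act x s.
Proof.
by rewrite (linB (act_linr x)) (linD (act_linr x)) (linB (act_linr x)).
Qed.
Let wedgeB x y z : wedge x (y - z) = wedge x y - wedge x z.
Proof. exact: (linB (wedge_linr x)). Qed.
Let wedgeD x y z : wedge x (y + z) = wedge x y + wedge x z.
Proof. exact: (linD (wedge_linr x)). Qed.
Let wedgeN x y : wedge (- x) y = - wedge x y.
Proof. exact: (linN (wedge_linl y)). Qed.
Let wedge_lier x y z : wedge x [lie y, z] = - wedge [lie y, z] x.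
Proof. exact: wedgeNC. Qed.

Fact chimod_jacobi X Y Z : chimod_lie X (chimod_lie Y Z) +
  chimod_lie Y (chimod_lie Z X) + chimod_lie Z (chimod_lie X Y) = 0.
Proof.
pose third (x1 y1 x2 y2 x3 y3 : heis) (t2 t3 : 'M[K]_(m + m * m)) :=
  act x1 (act x2 t3 - act x3 t2 + wedge y2 y3 - wedge x2 x3) +
  wedge y1 ([lie x2, y3] - [lie x3, y2]) -
  wedge x1 ([lie x2, x3] + [lie x2, x3]).
(* The terms act x (act y t) cancel by [actC], and the wedges because brackets
   act as derivations on them. *)
have third0 (x1 y1 x2 y2 x3 y3 : heis) (t1 t2 t3 : 'M[K]_(m + m * m)) :
    third x1 y1 x2 y2 x3 y3 t2 t3 + third x2 y2 x3 y3 x1 y1 t3 t1 +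
    third x3 y3 x1 y1 x2 y2 t1 t2 = 0.
  rewrite /third !act_sum !act_wedge !(wedgeB, wedgeD) !wedge_lier.
  rewrite (lieNC x2 x1) (lieNC x3 x2) (lieNC x1 x3) !wedgeN.
  rewrite (actC x2 x1) (actC x3 x2) (actC x1 x3); zmod.
rewrite /chimod_lie; congr (_, _, _) => /=.
- by rewrite !lieDr !heis_nil !addr0.
- rewrite !(lieNC (_ + _)) !lieBr !lieDr !heis_nil; zmod.
apply: etrans (third0 X.1.1 X.1.2 Y.1.1 Y.1.2 Z.1.1 Z.1.2 X.2 Y.2 Z.2).
by congr (_ + _ + _); rewrite act_comm2 subr0.
Qed.
HB.instance Definition _ := Lmodule_isLie.Build K chimod
  chimod_lieDZl chimod_lieDZr chimod_liexx chimod_jacobi.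

End Model.

Section Detection.
Context {K : fieldType} {m : nat} (g : lieAlgType K) (phi : g -> heis K m).
Hypothesis two_neq0 : (2%:R : K) != 0.
Hypothesis phi_hom : lie_hom phi.
Implicit Types x y z : g.

Let half : K := 2%:R^-1.
Let a x : chimod K m := (half *: phi x, half *: phi x, 0).
Let b x : chimod K m := (half *: phi x, - (half *: phi x), 0).

Let halfD (V : lmodType K) (x : V) : half *: x + half *: x = x.
Proof. by rewrite -scalerDl -mulr2n -mulr_natr mulVf ?scale1r. Qed.

Let act0 (x : heis K m) : act x (0 : 'M[K]_(m + m * m)) = 0.
Proof. exact: lin0 (act_linr x). Qed.

Let half_lin : lin (fun x => half *: phi x).
Proof. by move=> k x y; rewrite phi_hom.1 scalerDr !scalerA mulrC. Qed.

Let half_lie x y : [lie half *: phi x, half *: phi y] +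
  [lie half *: phi x, half *: phi y] = half *: phi [lie x, y].
Proof. by rewrite phi_hom.2 lieZl !lieZr halfD. Qed.

Let half_lieC x y : [lie half *: phi x, half *: phi y] =
  - [lie half *: phi y, half *: phi x].
Proof. exact: lieNC. Qed.

Let a_hom : lie_hom a.
Proof.
split=> [k x y|x y].
  congr (_, _, _); rewrite /= ?scaler0 ?addr0 //; exact: half_lin.
congr (_, _, _) => /=; first by rewrite half_lie.
  by rewrite (half_lieC y) opprK half_lie.
by rewrite !act0 !subrr add0r subrr.
Qed.

Let b_hom : lie_hom b.
Proof.
split=> [k x y|x y].
  congr (_, _, _); rewrite /= ?scaler0 ?addr0 //.
  by rewrite half_lin opprD scalerN.
congr (_, _, _) => /=; first by rewrite half_lie.
  by rewrite !lieNr (half_lieC y) opprK -opprD half_lie.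
rewrite !act0 subrr add0r (linN (wedge_linr _)) (linN (wedge_linl _)) opprK.
by rewrite subrr.
Qed.

Let ab_comm x : [lie a x, b x] = 0.
Proof.
congr (_, _, _) => /=; first by rewrite liexx addr0.
  by rewrite lieNr liexx oppr0 addr0.
by rewrite !act0 (linN (wedge_linr _)) wedgexx !subrr.
Qed.

(** F is the homomorphism induced by x |-> (c x + v x) / 2 and
    x' |-> (c x - v x) / 2. *)
Lemma chimod_detect : exists F : chi g -> chimod K m, lin F /\
  forall x y z, F (chi_f x y z) = (0, 0, heis_f (phi x) (phi y) (phi z)).
Proof.
have [F [Fh Fa Fb]] := chi_lift_ex a_hom b_hom ab_comm.
exists F; split=> [|x y z]; first exact: Fh.1.
have Fv t : F (chi_v t) = (0, phi t, 0) :> chimod K m.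
  rewrite (linB Fh.1) Fa Fb; congr (_, _, _) => /=; rewrite ?subrr //.
  by rewrite opprK halfD.
have Fw s t : F (chi_w s t) = (0, 0, wedge (phi s) (phi t)) :> chimod K m.
  rewrite Fh.2 !Fv; congr (_, _, _) => /=.
  - by rewrite lie0r addr0.
  - by rewrite !lie0r subrr.
  by rewrite !act0 subrr wedgexx add0r subr0.
rewrite !(linD Fh.1) !Fw !phi_hom.2.
by congr (_, _, _); rewrite /= !addr0.
Qed.
End Detection.

(** * Dual coordinates *)

Section Dual.
Context {K : fieldType} {m : nat}.
Implicit Types a b d : 'I_m.

Definition heis_gen a : heis K m := row_mx (delta_mx 0 a) 0.

Definition idx1 a : 'I_(m + m * m) := lshift (m * m) a.
Definition idx2 (s : 'I_m * 'I_m) : 'I_(m + m * m) :=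
  rshift m (mxvec_index s.1 s.2).

Let gen_idx1 a (i : 'I_m) : heis_gen a 0 (idx1 i) = (i == a)%:R.
Proof. by rewrite row_mxEl mxE. Qed.
Let gen_idx2 a s : heis_gen a 0 (idx2 s) = 0.
Proof. by rewrite row_mxEr mxE. Qed.
Let lie_idx1 (x y : heis K m) (i : 'I_m) : [lie x, y] 0 (idx1 i) = 0.
Proof. by rewrite row_mxEl mxE. Qed.
Let lie_idx2 a b s : [lie heis_gen a, heis_gen b] 0 (idx2 s) =
  (s == (a, b))%:R - (s == (b, a))%:R.
Proof.
case: s => c d; rewrite row_mxEr mxvecE !row_mxKl !trmx_delta !mul_delta_mx.
by rewrite !mxE.
Qed.

Let lie_idx2_sorted (s t : 'I_m * 'I_m) : (s.1 < s.2)%N -> (t.1 < t.2)%N ->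
  [lie heis_gen s.1, heis_gen s.2] 0 (idx2 t) = (t == s)%:R.
Proof.
case: s t => [a b] [c d] /= ab cd; rewrite lie_idx2.
have -> : ((c, d) == (b, a)) = false; last by rewrite subr0.
by apply/eqP => -[cb da]; move: cd; rewrite cb da ltnNge ltnW.
Qed.

Let wedgeE (x y : heis K m) p q :
  wedge x y p q = x 0 p * y 0 q - y 0 p * x 0 q.
Proof. by rewrite !mxE !big_ord1 !mxE. Qed.

(** The matrix entry that detects the basis element with index j. *)
Definition R_coord (j : R_idx m) : 'I_(m + m * m) * 'I_(m + m * m) :=
  match j with
  | inl (a, b, d) => (idx2 (a, b), idx1 d)
  | inr (s, t) => (idx2 t, idx2 s)
  end.

Let heis_fE (x y z : heis K m) p q : heis_f x y z p q =
  wedge [lie x, y] z p q + wedge [lie y, z] x p q + wedge [lie z, x] y p q.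
Proof. by rewrite /heis_f [LHS]mxE [X in X + _]mxE. Qed.

Let wedge_21 (a b d i : 'I_m) s :
  wedge [lie heis_gen a, heis_gen b] (heis_gen d) (idx2 s) (idx1 i) =
  [lie heis_gen a, heis_gen b] 0 (idx2 s) * (i == d)%:R.
Proof. by rewrite wedgeE gen_idx1 gen_idx2 mul0r subr0. Qed.

Let wedge_22 (a b d : 'I_m) s t :
  wedge [lie heis_gen a, heis_gen b] (heis_gen d) (idx2 s) (idx2 t) = 0.
Proof. by rewrite wedgeE !gen_idx2 mul0r mulr0 subrr. Qed.

Let heis_f_21 (a b d i : 'I_m) s :
  heis_f (heis_gen a) (heis_gen b) (heis_gen d) (idx2 s) (idx1 i) =
  [lie heis_gen a, heis_gen b] 0 (idx2 s) * (i == d)%:R +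
  [lie heis_gen b, heis_gen d] 0 (idx2 s) * (i == a)%:R +
  [lie heis_gen d, heis_gen a] 0 (idx2 s) * (i == b)%:R.
Proof. by rewrite heis_fE; congr (_ + _ + _); exact: wedge_21. Qed.

Let heis_f_22 (a b d : 'I_m) s t :
  heis_f (heis_gen a) (heis_gen b) (heis_gen d) (idx2 s) (idx2 t) = 0.
Proof.
have sum0 (x y z : K) : x = 0 -> y = 0 -> z = 0 -> x + y + z = 0.
  by move=> -> -> ->; rewrite !addr0.
by rewrite heis_fE; apply: sum0; exact: wedge_22.
Qed.

Definition R_val (j : R_idx m) : 'M[K]_(m + m * m) :=
  match j with
  | inl (a, b, d) => heis_f (heis_gen a) (heis_gen b) (heis_gen d)
  | inr (s, t) =>
    heis_f [lie heis_gen s.1, heis_gen s.2] (heis_gen t.1) (heis_gen t.2)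
  end.

(* The other two terms contain a triple commutator. *)
Let R_val4 s t : R_val (inr (s, t)) =
  wedge [lie heis_gen t.1, heis_gen t.2] [lie heis_gen s.1, heis_gen s.2].
Proof.
rewrite /= /heis_f heis_nil (lieNC _ (heis_gen t.1)) heis_nil oppr0.
by rewrite !(lin0 (wedge_linl _)) add0r addr0.
Qed.

Lemma R_dual (i j : R_idx m) : R_sorted i -> R_sorted j ->
  R_val i (R_coord j).1 (R_coord j).2 = (i == j)%:R.
Proof.
case: i => [[[a b] d]|[s t]]; case: j => [[[a' b'] d']|[s' t']].
- move=> /= /andP[ab bd] /andP[ab' bd'].
  rewrite [LHS]heis_f_21.
  have -> p :
      [lie heis_gen d, heis_gen a] 0 p = - [lie heis_gen a, heis_gen d] 0 p.
    by rewrite lieNC [LHS]mxE.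
  have lie_lt (e e' : 'I_m) : (e < e')%N ->
      [lie heis_gen e, heis_gen e'] 0 (idx2 (a', b')) =
      ((a', b') == (e, e'))%:R.
    by move=> ee'; exact: (lie_idx2_sorted (s := (e, e')) (t := (a', b'))).
  rewrite !lie_lt //; last exact: ltn_trans bd.
  (* In the two unwanted terms d' is a or b, while b' = d is larger than both;
     but b' < d'. *)
  have no3 (e e' h : 'I_m) : (h < e')%N ->
      (((a', b') == (e, e'))%:R * (d' == h)%:R : K) = 0.
    move=> he'; case: eqP => [[_ be']|_]; last by rewrite mul0r.
    case: eqP => [dh|_]; last by rewrite mulr0.
    by move: bd'; rewrite be' dh ltnNge ltnW.
  rewrite mulNr (no3 b d a) ?(no3 a d b) //; last exact: ltn_trans bd.
  rewrite oppr0 !addr0 -natrM mulnb.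
  by rewrite -xpair_eqE eq_sym.
- move=> _ _; exact: heis_f_22.
- by move=> _ _; rewrite R_val4 wedgeE !lie_idx1 !mulr0 subrr.
move=> /= /and3P[s12 t12 st] /and3P[s12' t12' st'].
rewrite -/(R_val (inr (s, t))) R_val4 wedgeE !lie_idx2_sorted // -!natrM !mulnb.
(* The second term of the wedge would need the two pairs in the wrong order. *)
have -> : (t' == s) && (s' == t) = false.
  apply/negbTE/negP => /andP[/eqP t's /eqP s't].
  by move: st'; rewrite t's s't /pair_lt ltnNge ltnW.
by rewrite subr0 andbC -xpair_eqE eq_sym.
Qed.
End Dual.

(** * The free nilpotent Lie algebras of class 2 and 3 *)

Lemma lcs_lie (K : fieldType) (g : lieAlgType K) k (x y : g) :
  lcs g k.+1 y -> lcs g k.+2 [lie x, y].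
Proof. by move=> gy; apply: mem_lspan; exists x => //; exists y. Qed.

Lemma lcs_class2_hom (K : fieldType) (g h : lieAlgType K) (f : g -> h) k
    (x : g) :
  lie_hom f -> (forall x y z : h, [lie x, [lie y, z]] = 0) ->
  lcs g k.+3 x -> f x = 0.
Proof.
move=> fh nil; have sk := subspace_ker fh.1.
elim: k x => [|k IH]; apply: (lspan_min sk) => _ [a _ [b gb <-]] /=.
  rewrite fh.2; move: b gb; apply: lspan_min.
    apply: (subspace_ker (h := fun b => [lie f a, f b])).
    by move=> t x y; rewrite fh.1 lieDZr.
  by move=> _ [u _ [v _ <-]] /=; rewrite fh.2 nil.
by rewrite fh.2 (IH b gb) lier0.
Qed.

Section FreeNilpotent.
Context (K : fieldType) (m c : nat).
Hypothesis two_neq0 : (2%:R : K) != 0.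
Hypothesis c23 : (1 < c < 4)%N.
Local Notation n := (free_nilpotent K m c).

Definition nil_gen (i : 'I_m) : n := lieq_pi _ (fl_gen K i).

Let nil4 (x y z t : n) : [lie [lie [lie x, y], z], t] = 0.
Proof.
have lcs4 (x' y' z' t' : freeLie K 'I_m) :
    lcs (freeLie K 'I_m) c.+1 [lie t', [lie z', [lie x', y']]].
  have xyz : lcs (freeLie K 'I_m) 3 [lie z', [lie x', y']].
    by do 2!apply: lcs_lie.
  case: c c23 => [|[|[|[|]]]] //= _; first exact: (lcs_subproof _ 3).2.
  exact: lcs_lie.
rewrite (lieNC _ t) (lieNC _ z) lieNr opprK.
rewrite -[x]lieq_reprK -[y]lieq_reprK -[z]lieq_reprK -[t]lieq_reprK.
move: (lieq_repr x) (lieq_repr y) (lieq_repr z) (lieq_repr t) => x' y' z' t'.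
have pi_lie := (lieq_pi_hom (lcs_ideal (freeLie K 'I_m) c.+1)).2.
rewrite -(pi_lie x' y') -(pi_lie z') -(pi_lie t').
rewrite -(lieq_pi0 (lcs_ideal _ c.+1)); apply/lieq_piP.
by rewrite subr0; exact: lcs4.
Qed.

Let nil_ind (P : set n) : subspace P -> (forall i, P (nil_gen i)) ->
  (forall x y, P [lie x, y]) -> forall x, P x.
Proof.
move=> sP Pg Pl x; rewrite -[x]lieq_reprK.
apply: (@free_ind _ _ (@lieq_pi _ _ (lcs_ideal _ c.+1) @^-1` P)).
- by apply: subspace_preim => //; exact: (lieq_pi_hom _).1.
- by move=> a b _ _; rewrite /preimage /= (lieq_pi_hom _).2.
exact: Pg.
Qed.

(* The lift of the generators to [heis] kills gamma_{c+1} since c is at least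
   2. *)
Let phi_ex : exists phi : n -> heis K m,
  lie_hom phi /\ forall i, phi (nil_gen i) = heis_gen i.
Proof.
have Fh := fl_lift_hom (@heis_gen K m).
have F0 x : lcs_ideal (freeLie K 'I_m) c.+1 x -> fl_lift (@heis_gen K m) x = 0.
  case: c c23 => [|[|k]] // _; apply: (lcs_class2_hom (k := k)) => //.
  exact: heis_nil.
exists (lieq_lift (fl_lift (@heis_gen K m))); split; first exact: lieq_lift_hom.
by move=> i; rewrite /nil_gen lieq_liftE // fl_lift_gen.
Qed.

Lemma chiR_basis : exists e : R_idx m -> chi n,
  basis_of (chiR n) (e @` @R_sorted m) /\ {in @R_sorted m &, injective e}.
Proof.
have [phi [phi_hom phi_gen]] := phi_ex.
have [F [Flin Ff]] := chimod_detect two_neq0 phi_hom.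
exists (R_gen nil_gen).
pose co (j : R_idx m) z : K := (F z).2 (R_coord j).1 (R_coord j).2.
apply: (dual_family_basis (co := co)).
- by move=> j _ a x y; rewrite /co Flin /= !mxE.
- move=> i j Di Dj; rewrite /co.
  have -> : (F (R_gen nil_gen i)).2 = R_val i; last exact: R_dual.
  case: i Di => [[[a b] d]|[s t]] _ /=; rewrite Ff /=.
    by rewrite !phi_gen.
  by rewrite !phi_hom.2 !phi_gen.
by rewrite (chiR_gen_span two_neq0 nil4 nil_ind).
Qed.

End FreeNilpotent.

Theorem corollary5p4 (K : fieldType) (m : nat) :
  2%N \notin [pchar K]%R -> (1 <= m)%N ->
  same_dim (chiR (free_nilpotent K m 2)) (chiR (free_nilpotent K m 3)).
Proof.
move=> ch2 _; have two_neq0 : (2%:R : K) != 0 by rewrite inE in ch2.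
have [e [be einj]] := chiR_basis m two_neq0 (isT : 1 < 2 < 4)%N.
have [e' [be' einj']] := chiR_basis m two_neq0 (isT : 1 < 3 < 4)%N.
exists (e @` @R_sorted m), (e' @` @R_sorted m); split=> //.
apply: card_eq_trans (_ : @R_sorted m #= _)%card.
  exact: inj_card_eq.
rewrite card_eq_sym; exact: inj_card_eq.
Qed.
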